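(* Let $A$ and $B$ be finite non-trivial groups. Then the equality $$\mathrm{var}(A \,\mathrm{wr}\, B) = \mathrm{var}(A)\,\mathrm{var}(B)$$ holds if and only if all of the following conditions hold: (a) the exponents of the groups $A$ and $B$ are coprime; (b) $A$ is a nilpotent group and $B$ is an abelian group; (c) $B$ contains a subgroup isomorphic to the direct product $C_n^c$ of $c$ copies of the cyclic group $C_n$ of order $n$, where $c$ is the nilpotency class of $A$ and $n$ is the exponent of $B$.
   Context: A variety of groups is a class of groups defined by a set of laws (equivalently, closed under homomorphic images, subgroups and Cartesian products). For a group $G$, $\mathrm{var}(G)$ denotes the variety generated by $G$, i.e. the smallest variety containing $G$. For varieties $\mathfrak U$ and $\mathfrak V$, the product variety $\mathfrak U\mathfrak V$ consists of all extensions of groups $N\in\mathfrak U$ by groups $Q\in\mathfrak V$, i.e. of all groups $E$ having a normal subgroup $N\in\mathfrak U$ with $E/N\in\mathfrak V$. $A\,\mathrm{wr}\,B$ denotes the standard (regular) wreath product with passive group $A$ and active group $B$: the semidirect product $A^{B}\rtimes B$, where $A^B$ is the direct product of copies of $A$ indexed by $B$ (the base subgroup) and $B$ permutes the copies by its regular action on indices. *)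

(* Defs.v *)
From HB Require Import structures.
From mathcomp Require Import all_boot all_fingroup all_algebra all_solvable.

Set Implicit Arguments.
Unset Strict Implicit.
Unset Printing Implicit Defensive.

Local Open Scope group_scope.

(* A word x_{i1}^{e1} ... x_{ik}^{ek} in countably many letters and their
   inverses; the letter (i, false) is x_i and (i, true) is x_i^-1.           *)
Definition word := seq (nat * bool).

Definition word_eval (G : groupType) (s : nat -> G) (w : word) : G :=
  \prod_(l <- w) (if l.2 then (s l.1)^-1 else s l.1).

Definition satisfies_law (G : groupType) (w : word) : Prop :=
  forall s : nat -> G, word_eval s w = 1.

(* groupType contains the infinite groups as well as the finite ones. *)
Definition group_class := groupType -> Prop.

Definition eq_group_class (U V : group_class) : Prop :=
  forall G : groupType, U G <-> V G.

Definition variety_of_laws (L : word -> Prop) : group_class :=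
  fun G => forall w, L w -> satisfies_law G w.

Definition is_variety (V : group_class) : Prop :=
  exists L : word -> Prop, eq_group_class V (variety_of_laws L).

(* The intersection of all varieties containing G: see var_variety, var_mem
   and var_min.                                                              *)
Definition var (G : groupType) : group_class :=
  fun H => forall V : group_class, is_variety V -> V G -> V H.

Lemma var_variety (G : groupType) : is_variety (var G).
Proof.
exists (satisfies_law G) => H; split=> [varH | lawH V [L VL] /VL LG].
  apply: varH; last by [].
  by exists (satisfies_law G) => K.
by apply/VL => w /LG; apply: lawH.
Qed.

Lemma var_mem (G : groupType) : var G G.
Proof. by move=> V _. Qed.

Lemma var_min (G : groupType) (V : group_class) :
  is_variety V -> V G -> forall H, var G H -> V H.
Proof. by move=> varV VG H; apply. Qed.

(* E is an extension of N by Q: the exactness of 1 -> N -> E -> Q -> 1 says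
   that the image of N is a normal subgroup whose quotient in E is Q.        *)
Definition is_extension (N E Q : groupType)
    (i : {multiplicative N -> E}) (p : {multiplicative E -> Q}) : Prop :=
  [/\ injective i,
      forall q, exists e, p e = q &
      forall e, p e = 1 <-> exists n, i n = e].

Definition product_variety (U V : group_class) : group_class :=
  fun E => exists (N Q : groupType)
    (i : {multiplicative N -> E}) (p : {multiplicative E -> Q}),
    [/\ U N, V Q & is_extension i p].

Section Wreath.

Variables A B : finGroupType.

(* b moves the copy of A with index y to the copy with index y * b. *)
Definition wreath_act (f : {dffun forall _ : B, A}) (b : B) :
    {dffun forall _ : B, A} :=
  [ffun x => f (x * b^-1)].

Fact wreath_act1 : wreath_act^~ 1 =1 id.
Proof. by move=> f; apply/ffunP => x; rewrite ffunE invg1 mulg1. Qed.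

Fact wreath_actM f : act_morph wreath_act f.
Proof. by move=> b c; apply/ffunP => x; rewrite !ffunE invMg mulgA. Qed.

Canonical wreath_action := TotalAction wreath_act1 wreath_actM.

Fact wreath_is_groupAction :
  is_groupAction [set: {dffun forall _ : B, A}] wreath_action.
Proof.
move=> b _; rewrite inE; apply/andP; split.
  by apply/subsetP => f _; rewrite inE.
by apply/morphicP => f g _ _; apply/ffunP => x; rewrite !actpermE !ffunE.
Qed.

Definition wreath_groupAction := GroupAction wreath_is_groupAction.

(* As B is finite, the direct power A^B is the set of all functions B -> A,
   i.e. the external direct product of copies of A indexed by B.             *)
Definition wreath : finGroupType := sdprod_by wreath_groupAction.

End Wreath.

(* C_n^c, for n > 0; Zp n is the additive group of integers modulo n. *)
Definition cyclic_power (n c : nat) : {set {dffun 'I_c -> 'Z_n}} :=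
  setXn (fun _ : 'I_c => Zp n).

(* Main.v *)
Require Import Defs.
From mathcomp Require Import all_boot all_fingroup all_algebra all_solvable.
From HB Require Import structures.
From mathcomp Require Import zify.
From Stdlib Require Import ClassicalEpsilon.

(** Write W for A wr B, n for the exponent of B and c for the nilpotency class
   of A.

   One inclusion always holds: if E is in var W, the values of the laws of B
   in E form a normal subgroup N with E / N in var B, and N is in var A because
   in W such values lie in the base group, a power of A (var_wreath_product).

   Necessity. If the varieties are equal, var W contains A wr Q for every power
   Q of B.
   - On W at most |W| ^ (|W| ^ k) functions are given by words in k letters,
     whereas on A wr Q words over A can be applied to many independent
     conjugates of one base element, numbered by words over B
     (separated_nested_card). If B is not abelian or A is not nilpotent,
     products of commutators indexed by sets of letters give too many words
     (separated_commutators).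
   - If a prime p divides both exponents, the groups <a> wr <b> ^ k with a
     and b of order p are p-groups of unbounded class, but finite p-groups in var W
     are sections of powers of W and have bounded class (var_pgroup_lnc).
   - If B does not contain C_n ^ c, any c elements of B satisfy a relation
     with an entry n / q, q prime. Let y_i be base elements and t_i elements
     of W, for i < c. Averaging the conjugates of y_i over the t_j with a
     suitable kernel in the direction of t_i gives an element which is trivial
     modulo the derived subgroup as soon as the relation has i-th entry n / q.
     The commutator of weight c of these c averages is therefore a law of W
     (rank_word_law), but not of A wr B ^ c (rank_word_nonlaw).

   Sufficiency. Let E be an extension of N in var A by Q in var B, and w a law
   of W in the letters I. Put M = Z_n ^ I. Following the path of w in the Cayley
   graph of M rewrites w to a word v in the letters I * M, and the value of w in E
   is a value of v at Schreier generators in N (law_extension). So it is enough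
   that v is a law of A. The same rewriting in W shows that v is trivial at every
   function f : I * M -> A which factors through a homomorphism from M to B. As B
   contains C_n ^ c, this applies to products of at most c functions each of
   which depends on M through one character M -> Z_n (path_law_few). As A has
   class c, a word which is trivial at all subproducts of at most c factors is
   trivial at the whole product (geval_few_factors). Finally every f is a
   product of functions of one character, by Fourier inversion on M, for which n
   must be invertible modulo the exponent of A (char_expansion).

   Roots of unity are avoided by the kernel kern on Z_n, the product over the
   primes q dividing n of 1 - [n / q] in the group ring. It is 1 at 0, and its sum
   over any coset of a nontrivial subgroup vanishes modulo the exponent of A. *)

Set Implicit Arguments.
Unset Strict Implicit.
Unset Printing Implicit Defensive.

Local Open Scope group_scope.

(** * Morphisms given by their graph *)

Section MultiplicativeMaps.

Variables (G H : groupType) (f : G -> H).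
Hypothesis fM : {morph f : x y / x * y}.

Lemma mmorph1 : f 1 = 1.
Proof. by apply: (mulgI (f 1)); rewrite -fM !mulg1. Qed.

Lemma mmorphV x : f x^-1 = (f x)^-1.
Proof. by apply: (mulgI (f x)); rewrite -fM !mulgV mmorph1. Qed.

Lemma mmorphX x n : f (x ^+ n) = f x ^+ n.
Proof. by elim: n => [|n IHn]; rewrite ?mmorph1 // !expgS fM IHn. Qed.

End MultiplicativeMaps.

(** * Words over an arbitrary alphabet *)

Definition gword (X : Type) := seq (X * bool).

(** At the alphabet nat this is convertible to word_eval. *)
Definition geval (X : Type) (G : groupType) (s : X -> G) (w : gword X) : G :=
  \prod_(l <- w) (if l.2 then (s l.1)^-1 else s l.1).

Section Words.

Variable X : Type.
Implicit Types (u v w : gword X) (G : groupType).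

Definition wvar (x : X) : gword X := [:: (x, false)].
Definition winv w : gword X := rev [seq (l.1, ~~ l.2) | l <- w].
Definition wpow w n : gword X := iter n (cat w) [::].
Definition wconj u v : gword X := winv v ++ u ++ v.
Definition wcomm u v : gword X := winv u ++ wconj u v.
Definition wprod (I : Type) (r : seq I) (F : I -> gword X) : gword X :=
  flatten [seq F i | i <- r].

Section Eval.

Variables (G : groupType) (s : X -> G).

Lemma geval_nil : geval s [::] = 1. Proof. exact: big_nil. Qed.

Lemma geval_cons l w :
  geval s (l :: w) = (if l.2 then (s l.1)^-1 else s l.1) * geval s w.
Proof. exact: big_cons. Qed.

Lemma geval_cat u v : geval s (u ++ v) = geval s u * geval s v.
Proof. exact: big_cat. Qed.

Lemma geval_var x : geval s (wvar x) = s x.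
Proof. exact: big_seq1. Qed.

Lemma geval_inv w : geval s (winv w) = (geval s w)^-1.
Proof.
elim: w => [|[x b] w IHw]; first by rewrite geval_nil invg1.
rewrite geval_cons invgM -IHw /winv /= rev_cons -cats1 geval_cat.
by rewrite {2}/geval big_seq1 /=; case: b; rewrite //= invgK.
Qed.

Lemma geval_pow w n : geval s (wpow w n) = geval s w ^+ n.
Proof.
elim: n => [|n IHn]; first exact: geval_nil.
by rewrite /wpow iterS geval_cat [geval s (iter _ _ _)]IHn expgS.
Qed.

Lemma geval_conj u v : geval s (wconj u v) = geval s u ^ geval s v.
Proof. by rewrite !geval_cat geval_inv conjgE. Qed.

Lemma geval_comm u v : geval s (wcomm u v) = [~ geval s u, geval s v].
Proof. by rewrite geval_cat geval_inv geval_conj. Qed.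

Lemma geval_prod (I : Type) (r : seq I) (F : I -> gword X) :
  geval s (wprod r F) = \prod_(i <- r) geval s (F i).
Proof.
elim: r => [|i r IHr]; first by rewrite big_nil geval_nil.
by rewrite big_cons /wprod /= geval_cat [geval s (flatten _)]IHr.
Qed.

End Eval.

Lemma eq_geval G (s t : X -> G) w : s =1 t -> geval s w = geval t w.
Proof. by move=> est; apply: eq_bigr => l _; rewrite est. Qed.

Lemma geval_morph (G H : groupType) (f : G -> H) (s : X -> G) w :
  {morph f : x y / x * y} -> f (geval s w) = geval (f \o s) w.
Proof.
move=> fM; rewrite (big_morph f fM (mmorph1 fM)).
by apply: eq_bigr => -[x []] _ //=; apply: mmorphV.
Qed.

End Words.

Arguments wvar {X}.

Definition wsubst (X Y : Type) (t : X -> gword Y) (w : gword X) : gword Y :=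
  wprod w (fun l => if l.2 then winv (t l.1) else t l.1).

Lemma geval_subst (X Y : Type) (G : groupType) (s : Y -> G) (t : X -> gword Y)
    (w : gword X) :
  geval s (wsubst t w) = geval (fun x => geval s (t x)) w.
Proof.
rewrite geval_prod; apply: eq_bigr => -[x b] _ /=.
by case: b; rewrite ?geval_inv.
Qed.

(** The left-normed commutator [x, y_1, ..., y_k], where s lists the y_i. *)
Definition lnc (G : groupType) (x : G) (s : seq G) : G := foldl commg x s.

Definition wlnc (X : Type) (w : gword X) (r : seq (gword X)) : gword X :=
  foldl (@wcomm X) w r.

Lemma geval_lnc (X : Type) (G : groupType) (s : X -> G) (w : gword X)
    (r : seq (gword X)) :
  geval s (wlnc w r) = lnc (geval s w) [seq geval s v | v <- r].
Proof. by elim: r w => //= v r IHr w; rewrite IHr geval_comm. Qed.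

(** * Varieties by laws *)

Lemma varP (G H : groupType) :
  var G H <-> forall w, satisfies_law G w -> satisfies_law H w.
Proof.
split=> [vGH w wG | lawsH V [L VL] /VL VG].
  have /(_ _) := @var_min G (variety_of_laws (eq w)) _ _ H vGH; apply=> //.
    by exists (eq w).
  by move=> _ <-.
by apply/VL => w /VG; apply: lawsH.
Qed.

(** Numbering the letters turns w into a word in the letters x_0, x_1, ... *)
Lemma var_law (G H : groupType) (X : countType) (w : gword X) :
    var G H -> (forall s : X -> G, geval s w = 1) ->
  forall s : X -> H, geval s w = 1.
Proof.
move=> /varP vGH wG s; pose w' := wsubst (fun x : X => wvar (pickle x)) w.
have law: satisfies_law G w'.
  by move=> t; rewrite -[LHS]/(geval t w') geval_subst wG.
have := vGH _ law (fun n => if unpickle n is Some x then s x else 1).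
rewrite -[word_eval _ _]/(geval _ w') geval_subst => <-; apply: eq_geval => x.
by rewrite geval_var pickleK.
Qed.

(** The hypotheses say that the f i together embed H in a Cartesian power of
   G. *)
Lemma var_embed (G H : groupType) (I : Type) (f : I -> H -> G) :
    (forall i, {morph f i : x y / x * y}) ->
    (forall x, (forall i, f i x = 1) -> x = 1) ->
  var G H.
Proof.
move=> fM f_inj; apply/varP => w lawG s; apply: f_inj => i.
by rewrite [f i _](geval_morph s w (fM i)) [LHS]lawG.
Qed.

Lemma var_dffun (G : finGroupType) (I : finType) : var G {dffun I -> G}.
Proof.
apply: (@var_embed _ _ I (fun i (x : {dffun I -> G}) => x i)) => [i x y|x x1].
  by rewrite ffunE.
by apply/ffunP => i; rewrite x1 ffunE.
Qed.

(** * The wreath product *)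

Section WreathProduct.

Variables A B : finGroupType.
Local Notation W := (wreath A B).

Definition wtop (u : W) : B := (pair_of_sd u).1.

(** The type stores u as a product b * f, but this is the function f when u is
   written as f * b. With this convention the value of a word at x is read
   from left to right along a path of B that starts at x: see wbaseM. *)
Definition wbase (u : W) (x : B) : A := (pair_of_sd u).2 (x * wtop u).

Fact wmk_subproof (f : B -> A) (b : B) :
  (b, [ffun x => f (x * b^-1)]) \in
    setX [set: B] [set: {dffun forall _ : B, A}].
Proof. by rewrite !inE. Qed.

Definition wmk (f : B -> A) (b : B) : W :=
  SdPair (wreath_groupAction A B) (wmk_subproof f b).

Lemma wtop_mk f b : wtop (wmk f b) = b. Proof. by []. Qed.

Lemma wbase_mk f b x : wbase (wmk f b) x = f x.
Proof. by rewrite /wbase /wtop /= ffunE mulgK. Qed.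

Lemma wreath_eq (u v : W) : wtop u = wtop v -> wbase u =1 wbase v -> u = v.
Proof.
move=> eq_top eq_base; apply: val_inj; move: eq_top eq_base.
rewrite /wtop /wbase /wtop /=; case: u v => [[b f] /= _] [[c g] /= _] <- fg.
by congr (_, _); apply/ffunP=> x; have /= := fg (x * b^-1); rewrite mulgVK.
Qed.

Lemma wtopM : {morph wtop : u v / u * v}. Proof. by []. Qed.

Lemma wbaseM u v x : wbase (u * v) x = wbase u x * wbase v (x * wtop u).
Proof.
by rewrite /wbase wtopM /= !ffunE !mulgA mulgK.
Qed.

Lemma wtop1 : wtop 1 = 1. Proof. by []. Qed.

Lemma wbase1 x : wbase 1 x = 1. Proof. by rewrite /wbase /= ffunE. Qed.

Lemma wtopV u : wtop u^-1 = (wtop u)^-1. Proof. by []. Qed.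

Lemma wbaseV u x : wbase u^-1 x = (wbase u (x * (wtop u)^-1))^-1.
Proof.
apply: (mulgI (wbase u (x * (wtop u)^-1))); rewrite mulgV.
by rewrite -{2}[x](mulgVK (wtop u)) -wbaseM mulgV wbase1.
Qed.

Lemma wbaseJ u v x : wtop u = 1 ->
  wbase (u ^ v) x =
    wbase u (x * (wtop v)^-1) ^ wbase v (x * (wtop v)^-1).
Proof.
by move=> u1; rewrite !wbaseM wbaseV wtopV u1 mulg1.
Qed.

Definition base_elt (f : {dffun B -> A}) : W := wmk f 1.
Definition active_elt (b : B) : W := wmk (fun=> 1) b.

Lemma base_eltM : {morph base_elt : f g / f * g}.
Proof.
move=> f g; apply: wreath_eq => [|x]; first by rewrite wtopM !wtop_mk mulg1.
by rewrite wbaseM !wbase_mk wtop_mk mulg1 ffunE.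
Qed.

Lemma active_eltM : {morph active_elt : b c / b * c}.
Proof.
by move=> b c; apply: wreath_eq => // x; rewrite wbaseM !wbase_mk mulg1.
Qed.

Lemma active_eltV b : active_elt b^-1 = (active_elt b)^-1.
Proof.
exact: mmorphV active_eltM b.
Qed.

Lemma base_eltE (u : W) : wtop u = 1 -> u = base_elt [ffun x => wbase u x].
Proof. by move=> u1; apply: wreath_eq => // x; rewrite wbase_mk ffunE. Qed.

Lemma base_eltJ f b : base_elt f ^ active_elt b =
  base_elt [ffun x => f (x * b^-1)].
Proof.
apply: wreath_eq => [|x]; first by rewrite !wtopM wtopV !wtop_mk mul1g mulVg.
by rewrite wbaseJ // !wbase_mk ffunE conjg1.
Qed.

End WreathProduct.

Lemma wreath_product_variety (A B Q : finGroupType) :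
  var B Q -> product_variety (var A) (var B) (wreath A Q).
Proof.
move=> varBQ; pose i := @base_elt A Q.
pose im := HB.pack_for {multiplicative {dffun Q -> A} -> wreath A Q} i
  (isMultiplicative.Build _ _ i (@base_eltM A Q)).
pose pm := HB.pack_for {multiplicative wreath A Q -> Q} (@wtop A Q)
  (isMultiplicative.Build _ _ (@wtop A Q) (@wtopM A Q)).
exists {dffun Q -> A}, Q, im, pm; split=> //; first exact: var_dffun.
split=> [f g /(congr1 (@wbase A Q)) fg | q | u].
- by apply/ffunP=> x; have := congr1 (fun h => h x) fg; rewrite !wbase_mk.
- by exists (wmk (fun=> 1) q).
split=> [u1 | [f <-] //].
by exists [ffun x => wbase u x]; apply/esym/base_eltE.
Qed.

(** * Left-normed commutators and nilpotency *)

Lemma lnc_rcons (G : groupType) (x : G) r y :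
  lnc x (rcons r y) = [~ lnc x r, y].
Proof. by rewrite /lnc -cats1 foldl_cat. Qed.

Lemma lnc1g (G : groupType) (r : seq G) : lnc 1 r = 1.
Proof. by elim: r => //= y r; rewrite comm1g. Qed.

Lemma lnc_mem1 (G : groupType) (x : G) r : 1 \in x :: r -> lnc x r = 1.
Proof.
rewrite in_cons => /predU1P[<- | ]; first exact: lnc1g.
elim: r x => //= y r IHr x; rewrite in_cons => /predU1P[<- | /IHr-> //].
by rewrite commg1 lnc1g.
Qed.

Lemma lnc_morph (G H : groupType) (f : G -> H) x r :
  {morph f : x y / x * y} -> f (lnc x r) = lnc (f x) [seq f y | y <- r].
Proof.
by move=> fM; elim: r x => //= y r IHr x; rewrite IHr !fM !mmorphV.
Qed.

Lemma mem_lnc_lcn (gT : finGroupType) (G : {group gT}) x r :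
  x \in G -> {subset r <= G} -> lnc x r \in 'L_(size r).+1(G).
Proof.
elim/last_ind: r => [//|r y IHr] Gx Gr.
rewrite lnc_rcons size_rcons lcnSn mem_commg //.
  by apply: IHr => // z rz; rewrite Gr // mem_rcons mem_behead.
by rewrite Gr // mem_rcons mem_head.
Qed.

Lemma lnc_nil_class (gT : finGroupType) (G : {group gT}) x r :
    nilpotent G -> nil_class G <= size r -> x \in G -> {subset r <= G} ->
  lnc x r = 1.
Proof.
by move=> nilG /lcn_nil_classP-/(_ nilG) L1 Gx /(mem_lnc_lcn Gx);
  rewrite L1 => /set1P.
Qed.

(** Omitting the last j entries of a trivial commutator leaves an element of
   the j-th term of the upper central series: its commutator with any element
   lies in the previous term. *)
Lemma lnc_trivial_nil (gT : finGroupType) n :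
    (forall (x : gT) r, size r = n -> lnc x r = 1) ->
  'Z_n([set: gT]) = [set: gT].
Proof.
move=> lnc1; suffices Zlnc j: j <= n ->
    forall (x : gT) r, size r = (n - j)%N -> lnc x r \in 'Z_j([set: gT]).
  apply/eqP; rewrite -subTset; apply/subsetP=> x _.
  by have := Zlnc n (leqnn n) x [::]; rewrite subnn; apply.
elim: j => [_ x r|j IHj le_jn x r sz_r].
  by rewrite subn0 => /lnc1->; rewrite group1.
rewrite ucnSnR !inE /=; apply/subsetP=> z.
case/(@gen_prodgP _ _ z) => k [c Dc ->]; apply: group_prod => i _.
have /imset2P[y1 y2 /set1P-> _ ->] := Dc i.
rewrite -lnc_rcons IHj 1?ltnW // size_rcons sz_r; lia.
Qed.

Lemma nonnil_lnc (gT : finGroupType) : ~~ nilpotent [set: gT] ->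
  forall n, exists (x : gT) r, size r = n /\ lnc x r <> 1.
Proof.
move=> nonnil n; apply: NNPP => no_r; case/negP: nonnil; apply/ucnP; exists n.
apply: lnc_trivial_nil => x r sz_r; apply: NNPP => r1.
by case: no_r; exists x, r.
Qed.

(** * Counting word functions *)

(** The size of such a family is a lower bound for the order of the free group
   of rank #|X| in var G. *)
Definition separated (G : groupType) (X J : Type) (u : J -> gword X) : Prop :=
  forall j k, j <> k -> exists s : X -> G, geval s (u j) <> geval s (u k).

Section SubsetCommutators.

Variables (G : groupType) (X : finType).

Definition subset_comm (S : {set X}) : gword X :=
  if enum S is x :: r then wlnc (wvar x) [seq wvar y | y <- r] else [::].

Lemma geval_subset_comm1 (s : X -> G) (S : {set X}) x :
  x \in S -> s x = 1 -> geval s (subset_comm S) = 1.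
Proof.
rewrite -mem_enum /subset_comm => + sx1; case: (enum S) => // y r ryx.
rewrite geval_lnc -map_comp geval_var; apply: lnc_mem1.
have ->: s y :: [seq (geval s \o wvar) z | z <- r] = [seq s z | z <- y :: r].
  by congr (_ :: _); apply: eq_map => z /=; rewrite geval_var.
by rewrite -sx1 map_f.
Qed.

Lemma geval_subset_comm_lnc (S : {set X}) (x : G) r : #|S| = (size r).+1 ->
  exists s : X -> G, geval s (subset_comm S) =
    lnc x r /\ forall z, z \notin S -> s z = 1.
Proof.
rewrite cardE => sz_S; pose s z := nth 1 (x :: r) (index z (enum S)).
have s_enum: [seq s z | z <- enum S] = x :: r.
  apply: (@eq_from_nth _ 1); rewrite size_map // => i lti.
  have [z0 _] : exists z0, z0 \in enum S.
    by case: (enum S) sz_S => // z e _; exists z; apply: mem_head.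
  by rewrite (nth_map z0) // /s index_uniq ?enum_uniq.
exists s; split=> [|z Sz]; last first.
  by rewrite /s nth_default // memNindex ?mem_enum // sz_S.
rewrite /subset_comm; case: (enum S) s_enum => // z e [<- <-].
rewrite geval_lnc geval_var -map_comp; congr lnc.
by apply: eq_map => t /=; rewrite geval_var.
Qed.

(** Products of the commutators subset_comm S over distinct families of sets S
   are distinct functions: among the sets on which the two families differ
   take S minimal and give the value 1 to the letters outside S. The
   commutators of sets not contained in S become trivial, those of proper
   subsets of S occur on both sides, and only the factor subset_comm S
   distinguishes the two products. *)
Lemma separated_commutators m :
    (forall n, n < m -> exists (x : G) r, size r = n /\ lnc x r <> 1) ->
  exists u : {set {S : {set X} | 0 < #|S| <= m}} -> gword X, separated G u.
Proof.
move=> ntG; pose P : finType := {S : {set X} | 0 < #|S| <= m}.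
pose f (T : {set P}) (S : P) := if S \in T then subset_comm (val S) else [::].
exists (fun T => wprod (enum P) (f T)) => T T' neqT.
have /existsP[S0 dS0]: [exists S, (S \in T) != (S \in T')].
  apply: contra_notT neqT => /existsPn eqT; apply/setP=> S.
  by have := eqT S; rewrite negbK => /eqP.
case: (@arg_minnP _ S0 (fun S => (S \in T) != (S \in T')) (fun S => #|val S|) dS0).
move=> S dS minS; have /andP[S_gt0 S_le_m] := valP S.
have [|x [r [sz_r lnc_r]]] := ntG #|val S|.-1; first lia.
have [|s [sS s1]] := @geval_subset_comm_lnc (val S) x r; first lia.
exists s; have enumS : S \in enum P by rewrite mem_enum.
have: uniq (enum P) by apply: enum_uniq.
rewrite !geval_prod; case/splitPr: enumS => r1 r2.
rewrite cat_uniq /= => /and3P[_ /norP[r1S _] /andP[r2S _]].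
have same S' : S' != S -> geval s (f T S') = geval s (f T' S').
  move=> neqS; rewrite /f;
    have [sS'S | /subsetPn[z S'z nSz]] := boolP (val S' \subset val S).
    have ltS': #|val S'| < #|val S|.
      by apply: proper_card; rewrite properEneq sS'S andbT (inj_eq val_inj).
    have [-> // | /minS] := eqVneq (S' \in T) (S' \in T').
    by rewrite leqNgt ltS'.
  have v1: geval s (subset_comm (val S')) = 1.
    exact: geval_subset_comm1 S'z (s1 z nSz).
  by case: ifP; case: ifP; rewrite ?v1 ?geval_nil.
have sameb r' : S \notin r' ->
    \prod_(i <- r') geval s (f T i) = \prod_(i <- r') geval s (f T' i).
  move=> Sr'; apply: eq_big_seq => S' r'S'; apply: same.
  by apply: contraNneq Sr' => <-.
rewrite !big_cat !big_cons !sameb // => /mulgI/mulIg; move: dS; rewrite /f.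
by do 2![case: ifP]; rewrite // sS geval_nil => _ _ _;
  first [exact: lnc_r | move/esym; exact: lnc_r].
Qed.

End SubsetCommutators.

(** Let Q be the power of B in which the words u j take distinct values q_j.
   The conjugates of a base element f by the inverses of the q_j take the
   independent values f(q_j) at the point 1, so applying the words v k to
   these conjugates gives words in the letters X and one more letter which are
   distinct on A wr Q, hence on W. On W there are only |W| ^ (|W| ^ (|X| + 1))
   functions of so many arguments. *)
Lemma separated_nested_card (A B W : finGroupType) (X J K : finType)
    (u : J -> gword X) (v : K -> gword J) :
    (forall Q : finGroupType, var B Q -> var W (wreath A Q)) ->
    separated B u -> separated A v ->
  #|K| <= #|W| ^ (#|W| ^ #|X|.+1).
Proof.
move=> varW sepu sepv; pose Q : finGroupType := {dffun {ffun X -> B} -> B}.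
pose w k : gword (option X) :=
  wsubst (fun j => wconj (wvar None) (winv (wsubst (fun x => wvar (Some x)) (u j))))
    (v k).
pose F k : {ffun {ffun option X -> W} -> W} :=
  [ffun s : {ffun option X -> W} => geval s (w k)].
suffices F_inj: injective F.
  by rewrite -(card_codom F_inj) -card_option -!card_ffun max_card.
move=> k k' eqF; apply: NNPP => neqk; have [s []] := sepv k k' neqk.
have lawW (t : option X -> W) : geval t (w k ++ winv (w k')) = 1.
  have evF l : F l [ffun x => t x] = geval t (w l).
    by rewrite ffunE; apply: eq_geval => x; rewrite ffunE.
  by rewrite geval_cat geval_inv -!evF eqF mulgV.
pose q j : Q := [ffun t : {ffun X -> B} => geval t (u j)].
have q_inj: injective q.
  have evq l (t : X -> B) : q l [ffun x => t x] = geval t (u l).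
    by rewrite ffunE; apply: eq_geval => x; rewrite ffunE.
  by move=> j j' eqq; apply: NNPP => /sepu[t]; rewrite -!evq eqq.
have varBQ: var B Q by apply: var_dffun.
pose f : {dffun Q -> A} := [ffun y => if [pick j | q j == y] is Some j then s j else 1].
pose t (x : option X) : wreath A Q :=
  if x is Some x then active_elt A ([ffun r : {ffun X -> B} => r x] : Q) else
    base_elt f.
have := var_law (varW Q varBQ) lawW t.
rewrite geval_cat geval_inv => /divg1_eq/(congr1 (fun z => wbase z 1)).
have eval_w l : wbase (geval t (w l)) 1 = geval s (v l).
  pose g j : {dffun Q -> A} := [ffun y => f (y * q j)].
  have conj_g j : geval t (wconj (wvar None)
      (winv (wsubst (fun x => wvar (Some x)) (u j)))) = base_elt (g j).
    rewrite geval_conj geval_var geval_inv geval_subst /=.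
    pose h x : Q := [ffun r : {ffun X -> B} => r x].
    rewrite (@eq_geval _ _ _ (@active_elt A Q \o h)) => [|x];
      last exact: geval_var.
    rewrite -(geval_morph _ _ (@active_eltM A Q)).
    have ->: geval h (u j) = q j.
      apply/ffunP=> r; rewrite (geval_morph (f := fun h : Q => h r)) => [|? ?].
        by rewrite ffunE; apply: eq_geval => x; rewrite /= ffunE.
      by rewrite ffunE.
    rewrite -active_eltV base_eltJ; congr base_elt; apply/ffunP=> y.
    by rewrite ffunE [RHS]ffunE invgK.
  rewrite geval_subst (@eq_geval _ _ _ (@base_elt A Q \o g)) => [|j];
    last exact: conj_g.
  rewrite -(geval_morph _ _ (@base_eltM A Q)) wbase_mk.
  rewrite (geval_morph (f := fun h : {dffun Q -> A} => h 1)) => [|? ?];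
    last by rewrite ffunE.
  apply: eq_geval => j /=; rewrite !ffunE mul1g.
  by case: pickP => [j' /eqP/q_inj-> // | /(_ j)]; rewrite eqxx.
by rewrite !eval_w.
Qed.

Lemma card_small_subsets (X : finType) m j : 0 < j <= m ->
  'C(#|X|, j) <= #|{: {S : {set X} | 0 < #|S| <= m}}|.
Proof.
move=> lt_j; rewrite card_sig -card_draws subset_leq_card //.
by apply/subsetP=> S; rewrite !inE => /eqP->.
Qed.

Lemma card_nonempty_subsets (X : finType) :
  #|{: {S : {set X} | 0 < #|S| <= #|X|}}| = (2 ^ #|X|).-1.
Proof.
have ->: (2 ^ #|X|)%N = #|{: {set X}}|.
  by rewrite -cardsT -card_powerset powersetT cardsT.
rewrite card_sig -(cardsC1 set0).
by rewrite -[LHS]cardsE; apply: eq_card => S;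
  rewrite !inE card_gt0 max_card andbT.
Qed.

Section Growth.

Variables A B W : finGroupType.
Hypothesis varW : forall Q : finGroupType, var B Q -> var W (wreath A Q).

(** The subset commutators are used twice: over B they provide the family J of
   inner words, over A the outer words. The bound is that of
   separated_nested_card after |W| <= 2 ^ |W|. *)
Lemma card_lnc_words (X : finType) mA mB
    (J := {set {S : {set X} | 0 < #|S| <= mB}}) :
    (forall n, n < mA -> exists (x : A) r, size r = n /\ lnc x r <> 1) ->
    (forall n, n < mB -> exists (x : B) r, size r = n /\ lnc x r <> 1) ->
  #|{: {S : {set J} | 0 < #|S| <= mA}}| <= #|W| ^ #|X|.+2.
Proof.
move=> /(@separated_commutators _ J)[v sepv].
move=> /(@separated_commutators _ X)[u sepu].
have := separated_nested_card varW sepu sepv; rewrite -cardsT -powersetT.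
rewrite card_powerset cardsT => le_card.
have W_gt0 : 0 < #|W| by apply/card_gt0P; exists 1.
have: 2 ^ #|{: {S : {set J} | 0 < #|S| <= mA}}| <= 2 ^ (#|W| * #|W| ^ #|X|.+1).
  apply: leq_trans le_card _; rewrite expnM leq_exp2r ?expn_gt0 ?W_gt0 //.
  exact/ltnW/ltn_expl.
by rewrite leq_exp2l // -expnS.
Qed.

Hypothesis ntB : [set: B] != 1.

Lemma nontrivial_lnc0 (G : finGroupType) : [set: G] != 1 ->
  forall n, n < 1 -> exists (x : G) r, size r = n /\ lnc x r <> 1.
Proof.
by case/trivgPn=> x _ /eqP ntx [] // _; exists x, [::].
Qed.

(** If B is not abelian, the commutators of pairs give 2 ^ C(k, 2) words in k
   letters over B, so the double exponential bound in k would exceed 2 ^ (2 ^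
   C(k, 2)). *)
Lemma product_active_abelian : [set: A] != 1 -> abelian [set: B].
Proof.
move=> ntA.
apply: contraT => /subsetPn[x _ /centP cx].
have [y ncxy]: exists y, ~ commute x y.
  by apply: NNPP => cxy; case: cx => y _; apply: NNPP => ncxy; case: cxy;
    exists y.
(* so that k (k - 1) / 2 > |W| (k + 2) *)
pose k := 4 * #|W| + 4.
have lncB n : n < 2 -> exists (x : B) r, size r = n /\ lnc x r <> 1.
  case: n => [|[|//]] _; first exact: nontrivial_lnc0.
  by exists x, [:: y]; split=> // /eqP/commgP.
have := @card_lnc_words 'I_k _ _ (nontrivial_lnc0 ntA) lncB.
move/(leq_trans (@card_small_subsets _ 1 1 isT)).
rewrite bin1 -cardsT -powersetT card_powerset cardsT card_ord => le1.
have: 2 ^ 'C(k, 2) <= 2 ^ (#|W| * k.+2).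
  apply: leq_trans (leq_trans le1 _).
    by have := @card_small_subsets 'I_k 2 2 isT; rewrite card_ord leq_exp2l.
  by rewrite expnM leq_exp2r // ltnW // ltn_expl.
have := bin2 k; rewrite leq_exp2l // => /[dup] bk -> {bk}.
rewrite /k; set w := #|W|; clear; rewrite addnS /= -divn2.
by rewrite leqNgt ltn_divRL //; nia.
Qed.

(** If A is not nilpotent, left-normed commutators of every weight survive and
   the number of words over A is doubly exponential in the number of letters.
   As B provides 2 ^ k letters from k, the double exponential bound would
   exceed a triple exponential. *)
Lemma product_base_nilpotent : nilpotent [set: A].
Proof.
apply: contraT => /nonnil_lnc-lncA.
(* so that 2 ^ k > |W| (k + 2) + 1 *)
pose k := 4 * #|W| + 8.
pose J : finType := {set {S : {set 'I_k} | 0 < #|S| <= 1}}.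
pose N := #|{: {S : {set 'I_k} | 0 < #|S| <= 1}}|.
have cardJ : #|J| = (2 ^ N)%N
  by rewrite -cardsT -powersetT card_powerset cardsT.
have := @card_lnc_words 'I_k #|J| 1 (fun n _ => lncA n) (nontrivial_lnc0 ntB).
rewrite card_nonempty_subsets cardJ card_ord => le1.
have leN: k <= N by have := @card_small_subsets 'I_k 1 1 isT;
  rewrite bin1 card_ord.
have: 2 ^ (2 ^ N) <= 2 ^ (#|W| * k.+2).+1.
  rewrite expnS; apply: leq_trans (_ : #|W| ^ k.+2 + 1 <= _); first lia.
  have: #|W| ^ k.+2 <= 2 ^ (#|W| * k.+2)
    by rewrite expnM leq_exp2r // ltnW // ltn_expl.
  have := expn_gt0 2 (#|W| * k.+2); lia.
rewrite leq_exp2l // => le2.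
have: (2 * #|W| + 5) ^ 2 <= 2 ^ N.
  apply: leq_trans (_ : 2 ^ k <= _); last by rewrite leq_exp2l.
  have ->: k = ((2 * #|W| + 4) * 2)%N by rewrite /k; lia.
  by rewrite expnM leq_exp2r // addnS ltn_expl.
move/leq_trans/(_ le2); rewrite /k; nia.
Qed.

End Growth.

(** * p-subgroups in the variety of a finite group *)

Section PGroups.

Variables W E : finGroupType.
Hypothesis varWE : var W E.

Local Notation Q := {dffun {ffun E -> W} -> W}.

(** These pairs generate the graph of a map onto E from a subgroup of a power
   of W. *)
Definition word_pair (e : E) : Q * E := ([ffun t : {ffun E -> W} => t e], e).

(** The first component of a word in the pairs is its word function on W; when
   it is trivial the word is a law of W, hence of E. So the generated group
   embeds in a power of W, and it projects onto E. *)
Lemma gen_word_pair_inj z :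
  z \in <<[set word_pair e | e : E]>> -> z.1 = 1 -> z.2 = 1.
Proof.
case/gen_prodgP=> n [c Dc ->].
have /fin_all_exists[e De] i : exists e, c i = word_pair e.
  by have /imsetP[e _ ->] := Dc i; exists e.
pose w := wprod (index_enum 'I_n) (fun i => wvar (e i)).
have zE : \prod_(i < n) c i = geval word_pair w.
  by rewrite geval_prod; apply: eq_bigr => i _; rewrite geval_var.
rewrite {}zE => z1; have lawW (s : E -> W) : geval s w = 1.
  have := congr1 (fun h : Q => h [ffun x => s x]) z1; rewrite ffunE.
  rewrite (geval_morph (f := fun y : Q * E => y.1 [ffun x => s x])) =>
    [<-|y y'].
    by apply: eq_geval => x /=; rewrite !ffunE.
  by rewrite ffunE.
by rewrite (geval_morph (f := fun y : Q * E => y.2)) // (var_law varWE lawW).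
Qed.

(** E is a section of a power of W by gen_word_pair_inj, so a Sylow argument
   presents P as the image of a p-subgroup of that power. The nilpotency class
   of the latter is at most that of a p-subgroup of W, which is less than |W|.
   *)
Lemma var_pgroup_lnc (p : nat) (P : {group E}) x r :
    p.-group P -> #|W| <= size r -> x \in P -> {subset r <= P} ->
  lnc x r = 1.
Proof.
move=> pP le_r Px Pr; pose D := <<[set word_pair e | e : E]>>.
pose S := D :&: @snd Q E @*^-1 P.
have [T sylT] := Sylow_exists p [group of S].
have imS : @snd Q E @* S = P.
  apply/setP=> y; apply/morphimP/idP =>
    [[z _ /setIP[_ /morphpreP[_ Pz]] ->] //|Py].
  exists (word_pair y) => //; rewrite !inE /= Py andbT.
  by apply/mem_gen/imsetP; exists y.
have imT : @snd Q E @* T = P.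
  have := morphim_pHall [morphism of @snd Q E] (subsetT _) sylT.
  rewrite /= imS => sylP; apply/eqP; rewrite eqEcard (pHall_sub sylP) /=.
  by rewrite (card_Hall sylP) part_pnat_id.
have lift y : y \in P -> exists2 z, z \in T & z.2 = y.
  by rewrite -imT => /morphimP[z _ Tz ->]; exists z.
have [y Ty yx] := lift x Px.
have [r' Tr' r'r] : exists2 r', {subset r' <= T} & [seq z.2 | z <- r'] = r.
  elim: r Pr {le_r} => [|z r IHr] Pr; first by exists [::].
  have [|r' Tr' <-] := IHr; first by move=> t rt; rewrite Pr // in_cons rt orbT.
  have [z' Tz' <-] := lift z (Pr z (mem_head _ _)).
  by exists (z' :: r') => // t; rewrite in_cons => /predU1P[->|/Tr'].
have Dlnc: lnc y r' \in D.
  have := mem_lnc_lcn Ty Tr'; apply/subsetP;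
    apply: subset_trans (lcn_sub _ _) _.
  by apply: subset_trans (pHall_sub sylT) (subsetIl _ _).
have <-: (lnc y r').2 = lnc x r
  by rewrite (lnc_morph (f := @snd Q E)) // yx r'r.
apply: gen_word_pair_inj Dlnc _; apply/ffunP=> t; rewrite ffunE.
have prM: {morph (fun z : Q * E => z.1 t) : z z' / z * z'}.
  by move=> z z'; rewrite ffunE.
rewrite (lnc_morph (f := fun z : Q * E => z.1 t)) //.
pose f := Morphism (in2W prM : {in [set: Q * E] &, _}).
have pfT: p.-group (f @* T) by rewrite morphim_pgroup ?(pHall_pgroup sylT).
apply: (@lnc_nil_class _ (f @* T)%G).
- exact: pgroup_nil pfT.
- rewrite size_map -(size_map snd) r'r; apply: leq_trans le_r.
  apply: leq_trans (max_card (mem (f @* T))); apply: ltnW.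
  by rewrite -nilpotent_class (pgroup_nil pfT).
- exact: mem_morphim.
by move=> _ /mapP[z /Tr' Tz ->]; apply: (mem_morphim f).
Qed.

End PGroups.

(** * Coprimality of the exponents *)

Section Coprime.

Variables (A B W : finGroupType) (p : nat) (a : A) (b : B).
Hypothesis varW : forall Q : finGroupType, var B Q -> var W (wreath A Q).
Hypotheses (p_pr : prime p) (oa : #[a] = p) (ob : #[b] = p).

Local Notation k := #|W|.
Local Notation Q := {dffun 'I_k -> B}.
Local Notation E := (wreath A Q).

(* The subgroup corresponding to <a> wr <b> ^ k, where k = |W|. *)
Let P := [set u : E | [forall i, wtop u i \in <[b]>] &&
                      [forall x, wbase u x \in <[a]>]].

Fact prime_wreath_group_set : group_set P.
Proof.
apply/group_setP; split=> [|u v].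
  by rewrite inE; apply/andP; split; apply/forallP=> x;
    rewrite ?wbase1 ?ffunE ?group1.
rewrite !inE => /andP[/forallP bu /forallP au] /andP[/forallP bv /forallP av].
by apply/andP; split; apply/forallP=> x; rewrite ?wbaseM ?ffunE groupM.
Qed.

Lemma cycle_expg_prime (gT : finGroupType) (x y : gT) :
  #[x] = p -> y \in <[x]> -> y ^+ p = 1.
Proof. by move=> <- /order_dvdG; rewrite order_dvdn => /eqP. Qed.

(** The group is an extension of a group of exponent p by another one. *)
Lemma prime_wreath_pgroup : p.-group (Group prime_wreath_group_set).
Proof.
apply/pgroupP=> q q_pr /Cauchy[] // u Pu ou.
have /forallP bu: [forall i, wtop u i \in <[b]>] by move: Pu;
  rewrite inE => /andP[].
have up1 : wtop (u ^+ p) = 1.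
  rewrite (mmorphX (@wtopM _ _)); apply/ffunP=> i.
  rewrite (mmorphX (f := fun h : Q => h i)) => [|? ?]; last by rewrite ffunE.
  by rewrite ffunE (cycle_expg_prime ob).
have upp1: (u ^+ p) ^+ p = 1.
  have := groupX p Pu; rewrite inE => /andP[_ /forallP au].
  rewrite (base_eltE up1) -(mmorphX (@base_eltM _ _)).
  apply: wreath_eq => // x; rewrite wbase_mk wbase1.
  rewrite (mmorphX (f := fun h : {dffun Q -> A} => h x)) => [|? ?];
    last by rewrite ffunE.
  by rewrite ffunE (cycle_expg_prime oa).
have: q %| p * p by rewrite -ou order_dvdn expgM upp1.
by rewrite Euclid_dvdM // orbb dvdn_prime2.
Qed.

Let f0 : {dffun Q -> A} := [ffun x => if x == 1 then a else 1].
Let t (i : 'I_k) : Q := dfung1 (gT := fun=> B) (i := i) b.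

(** Commuting with t i multiplies the support by the group generated by t i.
   As the t i are independent, the value at the point 1 is only inverted at
   each step. *)
Lemma lnc_prime_wreath r : uniq r ->
  exists g : {dffun Q -> A},
    [/\ lnc (base_elt f0) [seq active_elt A (t i) | i <- r] = base_elt g,
        g 1 \in [set a; a^-1] &
        forall (x : Q) i, i \notin r -> x i != 1 -> g x = 1].
Proof.
elim/last_ind: r => [_|r i IHr].
  exists f0; split=> //; first by rewrite ffunE eqxx set21.
  by move=> x i _ ntx; rewrite ffunE; case: (x =P 1) ntx => // ->;
    rewrite ffunE eqxx.
rewrite rcons_uniq => /andP[ri /IHr[g [defg g1 gx]]].
exists (g^-1 * [ffun x => g (x * (t i)^-1)]); split.
- by rewrite map_rcons lnc_rcons defg commgEl base_eltJ base_eltM mmorphV //;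
  apply: base_eltM.
- have ntb: (t i)^-1 i != 1.
    by rewrite ffunE dfung1_id invg_eq1 -order_gt1 ob prime_gt1.
  rewrite !ffunE mul1g (gx _ i) // mulg1.
  by case/set2P: g1 => ->; rewrite ?invgK ?set21 ?set22.
move=> x j; rewrite mem_rcons inE negb_or => /andP[neqji rj] xj.
rewrite eq_sym in neqji; have xj': (x * (t i)^-1) j != 1.
  by rewrite mulg_ffun invg_ffun dfung1_dflt // invg1 mulg1.
by rewrite mulg_ffun invg_ffun ffunE (gx x j) // (gx _ j) // invg1 mulg1.
Qed.

(** A commutator of weight |W| + 1 survives in a p-subgroup, against
   var_pgroup_lnc. *)
Lemma common_prime_contradiction : False.
Proof.
have [g [defg g1 _]] := lnc_prime_wreath (enum_uniq 'I_k).
have varE: var W E by apply: varW; apply: var_dffun.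
have nta: a != 1 by rewrite -order_gt1 oa prime_gt1.
suffices lnc1: base_elt g = 1.
  have := congr1 (fun u => wbase u 1) lnc1; rewrite wbase_mk wbase1 => g11.
  by case/set2P: g1; rewrite g11 => /esym/eqP; rewrite ?invg_eq1 (negPf nta).
rewrite -defg; apply: (var_pgroup_lnc varE prime_wreath_pgroup).
- by rewrite size_map -cardE card_ord.
- rewrite inE; apply/andP; split; apply/forallP=> x;
  first by rewrite ffunE group1.
  by rewrite wbase_mk ffunE; case: ifP; rewrite ?cycle_id ?group1.
move=> _ /mapP[i _ ->]; rewrite inE; apply/andP; split; apply/forallP=> x.
  have [-> | neq] := eqVneq i x; first by rewrite dfung1_id cycle_id.
  by rewrite dfung1_dflt ?group1.
by rewrite wbase_mk group1.
Qed.

End Coprime.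

Lemma product_coprime_exponents (A B W : finGroupType) :
    (forall Q : finGroupType, var B Q -> var W (wreath A Q)) ->
  coprime (exponent [set: A]) (exponent [set: B]).
Proof.
move=> varW; apply: contraT; rewrite coprime_sym /coprime.
set g := gcdn _ _ => g_neq1; exfalso.
have g_gt0 : 0 < g by rewrite gcdn_gt0 exponent_gt0.
have g_gt1 : 1 < g by rewrite ltn_neqAle eq_sym g_neq1.
have p_pr := pdiv_prime g_gt1; have p_g := pdiv_dvd g.
have [a _ oa] : {a | a \in [set: A] & #[a] = pdiv g}.
  by apply: Cauchy p_pr _; apply: dvdn_trans (exponent_dvdn _);
    apply: dvdn_trans p_g (dvdn_gcdr _ _).
have [b _ ob] : {b | b \in [set: B] & #[b] = pdiv g}.
  by apply: Cauchy p_pr _; apply: dvdn_trans (exponent_dvdn _);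
    apply: dvdn_trans p_g (dvdn_gcdl _ _).
exact: common_prime_contradiction varW p_pr oa ob.
Qed.

(** * Roots, and products of commuting elements *)

Lemma coprime_root (gT : finGroupType) (x : gT) N :
  coprime (exponent [set: gT]) N -> exists y, y ^+ N = x.
Proof.
move=> coN; have co_x : coprime #|<[x]>| N.
  by apply: coprime_dvdl coN; rewrite dvdn_exponent ?inE.
exists (x ^+ expg_invn <[x]> N); rewrite -expgnA mulnC expgnA.
by rewrite (expgK co_x) ?cycle_id.
Qed.

Lemma prodg_perm_commute (G : groupType) (I : eqType) (r1 r2 : seq I)
  (F : I -> G) :
    (forall i j, commute (F i) (F j)) -> perm_eq r1 r2 ->
  \prod_(i <- r1) F i = \prod_(i <- r2) F i.
Proof.
move=> cF; elim: r1 r2 => [|x r1 IHr] r2 eqr.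
  by case: r2 eqr => // y r2 /perm_size.
have r2x: x \in r2 by rewrite -(perm_mem eqr) mem_head.
case/splitPr: r2 / r2x eqr => s1 s2 eqr.
rewrite big_cons big_cat /= big_cons (IHr (s1 ++ s2)).
  rewrite big_cat /= mulgA [F x * _](commute_prod _ (fun i _ => cF x i)) //.
  by rewrite !mulgA.
by rewrite -(perm_cons x); apply: perm_trans eqr _;
  rewrite (perm_catCA s1 [:: x] s2).
Qed.

Lemma prodg_reindex_commute (G : groupType) (I : finType) (h : I -> I)
  (F : I -> G) :
    (forall i j, commute (F i) (F j)) -> injective h ->
  \prod_i F (h i) = \prod_i F i.
Proof.
move=> cF h_inj; rewrite -(big_map h predT F); apply: prodg_perm_commute => //.
apply: uniq_perm; rewrite ?map_inj_uniq ?index_enum_uniq //.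
have [g _ gK] := injF_bij h_inj.
by move=> x; rewrite mem_index_enum; apply/mapP; exists (g x);
  rewrite ?mem_index_enum.
Qed.

Lemma prodg_single (G : groupType) (I : finType) (F : I -> G) i :
  (forall j, j != i -> F j = 1) -> \prod_j F j = F i.
Proof.
move=> F1; have := index_enum_uniq I; have := mem_index_enum i.
case/splitPr=> r1 r2;
  rewrite cat_uniq /= => /and3P[_ /norP[r1i _] /andP[r2i _]].
rewrite big_cat big_cons /= !big1_seq ?mul1g ?mulg1 // => j /= r_j; apply: F1.
  by apply: contraNneq r2i => <-.
by apply: contraNneq r1i => <-.
Qed.

(** * Exponent vectors modulo n *)

Lemma cyclic_powerT n c :
  1 < n -> cyclic_power n c = [set: {dffun 'I_c -> 'Z_n}].
Proof.
move=> n_gt1; apply/setP=> x; rewrite in_setT.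
by apply/setXnP => i; rewrite /Zp n_gt1 in_setT.
Qed.

Section PowerMap.

Variables (n : nat) (I : finType) (G : groupType).
Hypotheses (n_gt1 : 1 < n) (cG : forall x y : G, commute x y).
Hypothesis expG : forall x : G, x ^+ n = 1.

Definition pw (b : I -> G) (mu : {ffun I -> 'Z_n}) : G :=
  \prod_i b i ^+ (mu i : nat).

Lemma expg_modZ (x : G) k : x ^+ ((k%:R : 'Z_n)%R : nat) = x ^+ k.
Proof.
rewrite val_Zp_nat // {2}(divn_eq k n) expgnDr mulnC expgnA expG.
by rewrite expg1n mul1g.
Qed.

Lemma pwD b mu nu : pw b (mu + nu)%R = pw b mu * pw b nu.
Proof.
rewrite /pw -prodgM_commute => [|*]; last exact: cG.
apply: eq_bigr => i _; rewrite ffunE -expgnDr -[RHS]expg_modZ GRing.natrD.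
by rewrite !natr_Zp.
Qed.

Lemma pw0 b : pw b 0%R = 1.
Proof. by rewrite /pw big1 // => i _; rewrite ffunE. Qed.

Lemma pwMn b mu k : pw b (mu *+ k)%R = pw b mu ^+ k.
Proof.
elim: k => [|k IHk]; first by rewrite GRing.mulr0n pw0.
by rewrite GRing.mulrS pwD IHk expgS.
Qed.

Definition unit_vec (i : I) : {ffun I -> 'Z_n} := [ffun j => (j == i)%:R]%R.

Lemma pw_unit b i : pw b (unit_vec i) = b i.
Proof.
rewrite /pw (@prodg_single _ _ _ i) => [|j /negPf ji].
  by rewrite ffunE eqxx (expg_modZ _ 1) expg1.
by rewrite ffunE ji.
Qed.

Lemma pw_additive (h : {ffun I -> 'Z_n} -> G) mu :
    (forall x y, h (x + y)%R = h x * h y) ->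
  h mu = pw (fun i => h (unit_vec i)) mu.
Proof.
move=> hD; have h0 : h 0%R = 1 by apply: (mulgI (h 0%R));
  rewrite -hD GRing.addr0 mulg1.
have hX x k : h (x *+ k)%R = h x ^+ k.
  by elim: k => [|k IHk]; rewrite ?GRing.mulr0n // GRing.mulrS hD IHk expgS.
have {1}-> : mu = (\sum_i unit_vec i *+ (mu i : nat))%R.
  apply/ffunP=> i; rewrite sum_ffunE (bigD1 i) //= big1 => [|j /negPf ij].
    by rewrite ffunMnE ffunE eqxx GRing.addr0 natr_Zp.
  by rewrite ffunMnE ffunE eq_sym ij GRing.mul0rn.
by rewrite (big_morph h hD h0); apply: eq_bigr => i _; apply: hX.
Qed.

End PowerMap.

(** A Bezout coefficient leads from x to g = gcd(x, k), and q is a prime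
   divisor of k / g. *)
Lemma Zn_multiple_step k (x : 'Z_k) : 1 < k -> x != 0%R ->
  exists q l, q \in primes k /\ (x *+ l = (k %/ q)%:R)%R.
Proof.
move=> k_gt1 nz_x; have k_gt0 := ltnW k_gt1.
have x_gt0 : 0 < (x : nat) by rewrite lt0n.
have lt_xk : x < k by rewrite -[X in _ < X](Zp_cast k_gt1).
pose g := gcdn x k; have g_gt0 : 0 < g by rewrite gcdn_gt0 x_gt0.
have kg_gt1 : 1 < k %/ g.
  rewrite ltn_divRL ?dvdn_gcdr // mul1n.
  by apply: leq_ltn_trans lt_xk; rewrite dvdn_leq ?dvdn_gcdl.
pose q := pdiv (k %/ g); have q_pr : prime q := pdiv_prime kg_gt1.
have dvd_q : q %| k %/ g := pdiv_dvd _.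
have [l El] : exists l, (x * l = g %[mod k])%N.
  by have [u v Euv _] := egcdnP k x_gt0; exists u; rewrite mulnC Euv modnMDl.
exists q, (l * (k %/ g %/ q))%N; split.
  rewrite mem_primes q_pr k_gt0 (dvdn_trans dvd_q) //.
  by rewrite -[X in _ %| X](divnK (dvdn_gcdr x k)) dvdn_mulr.
have E : (x *+ l = g%:R :> 'Z_k)%R.
  by apply: val_inj; rewrite -[x]natr_Zp -GRing.mulrnA /= !val_Zp_nat.
rewrite GRing.mulrnA E -GRing.mulrnA; congr (_%:R)%R.
by rewrite muln_divA // mulnC divnK ?dvdn_gcdr.
Qed.

(** * A kernel on the integers modulo n *)

Section Kernel.

Variables n m : nat.
Hypotheses (n_gt1 : 1 < n) (m_gt0 : 0 < m).

Local Notation step q := ((n %/ q)%:R : 'Z_n)%R.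

(** The coefficients of the product over q in s of the elements 1 - [n/q] of
   the group ring of Z_n, where -1 is represented by the natural number m - 1
   as the values are used as exponents in groups of exponent m. *)
Fixpoint kern (s : seq nat) (j : 'Z_n) : nat :=
  if s is q :: s' then (kern s' j + m.-1 * kern s' (j - step q)%R)%N
  else (j == 0%R).

(** The support consists of sums of elements n/q with q in s. *)
Lemma kern_supp s j : {in s, forall q, q %| n} -> kern s j != 0%N ->
  (j *+ (\prod_(q <- s) q)%N = 0)%R.
Proof.
elim: s j => [|q s IHs] j dvd_s /=.
  by rewrite big_nil GRing.mulr1n; case: (j =P 0%R).
have dvd_s' : {in s, forall q, q %| n} by move=> r sr;
  rewrite dvd_s // inE sr orbT.
rewrite big_cons addn_eq0 muln_eq0 !negb_and negb_or =>
  /orP[/IHs j0 | /andP[_ /IHs j0]].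
  by rewrite mulnC GRing.mulrnA j0 // GRing.mul0rn.
rewrite -[j](GRing.subrK (step q)) GRing.mulrnDl mulnC GRing.mulrnA j0 //.
have step0: (step q *+ q = 0)%R.
  by rewrite -GRing.mulrnA divnK ?dvd_s ?mem_head // pchar_Zp.
by rewrite GRing.mul0rn GRing.add0r mulnC GRing.mulrnA step0 GRing.mul0rn.
Qed.

(** Only the empty sum of distinct elements n/q vanishes: by kern_supp the
   sums over primes other than q are killed by an integer prime to q, while
   n/q is not. *)
Lemma kern0 s : uniq s -> {in s, forall q, prime q} ->
  {in s, forall q, q %| n} ->
  kern s 0%R = 1%N.
Proof.
elim: s => [_ _ _|q s IHs /= /andP[sq uniq_s] pr_s dvd_s]; first by [].
have sub_s : {subset s <= q :: s} by move=> r sr; rewrite inE sr orbT.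
rewrite IHs // => [|r /sub_s/pr_s //|r /sub_s/dvd_s //].
suffices ->: kern s (0 - step q)%R = 0%N by rewrite muln0.
apply/eqP/negPn/negP => /kern_supp-/(_ (sub_in1 sub_s dvd_s)).
rewrite GRing.sub0r GRing.mulNrn -GRing.mulrnA => /eqP.
rewrite GRing.oppr_eq0 -val_eqE /= val_Zp_nat // -/(dvdn _ _).
have q_pr := pr_s q (mem_head _ _); have dvd_q := dvd_s q (mem_head _ _).
have nq_gt0: 0 < n %/ q by rewrite divn_gt0 ?prime_gt0 // dvdn_leq // ltnW.
rewrite -{1}(divnK dvd_q) dvdn_pmul2l //.
rewrite big_seq; elim/big_rec: _ => [|r k sr IH].
  by rewrite dvdn1 => /eqP q1; rewrite q1 in q_pr.
rewrite Euclid_dvdM // => /orP[|/IH //].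
by rewrite dvdn_prime2 ?(pr_s r (sub_s r sr)) // => /eqP qr;
  rewrite qr sr in sq.
Qed.

(** The factor 1 - [n/q] of the kernel is split off. *)
Lemma kern_shift s q : q \in s ->
  exists g : 'Z_n -> nat, forall j, kern s j =
    (g j + m.-1 * g (j - step q)%R)%N.
Proof.
elim: s => //= r s IHs; rewrite inE => /predU1P[-> | /IHs[g Eg]].
  by exists (kern s).
exists (fun j => g j + m.-1 * g (j - step r)%R)%N => j; rewrite !Eg.
by rewrite (GRing.addrAC j) !mulnDr addnACA.
Qed.

(** Averaging against the kernel annihilates a function which is invariant
   under a translation d lying over n/q, because of the factor 1 - [n/q]: the
   two terms of kern_shift are exchanged by the translation. *)
Lemma prod_kern_invariant (G : groupType) (I : finType)
    (lam : {ffun I -> 'Z_n} -> 'Z_n) (d : {ffun I -> 'Z_n})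
    (h : {ffun I -> 'Z_n} -> G) s q :
    (forall mu nu, commute (h mu) (h nu)) -> (forall mu, h mu ^+ m = 1) ->
    {morph lam : x y / x + y >-> x + y}%R -> q \in s -> lam d = step q ->
    (forall mu, h (mu + d)%R = h mu) ->
  \prod_mu h mu ^+ kern s (lam mu) = 1.
Proof.
move=> c_h exp_h lamD sq lam_d h_d; have [g Eg] := kern_shift sq.
pose F mu := h mu ^+ g (lam mu).
have cF mu nu k : commute (F mu ^+ k) (F nu ^+ m.-1).
  by rewrite /F -!expgnA; apply: commuteX2.
rewrite (eq_bigr (fun mu => F mu * F (mu - d)%R ^+ m.-1)) => [|mu _];
  last first.
  rewrite Eg expgnDr mulnC expgnA /F -(h_d (mu - d)%R) GRing.subrK.
  suffices ->: lam (mu - d)%R = (lam mu - step q)%R by [].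
  by have := lamD (mu - d)%R d; rewrite GRing.subrK lam_d => ->;
    rewrite GRing.addrK.
rewrite prodgM_commute => [|mu nu _ _]; last exact: (cF mu _ 1%N).
rewrite (prodg_reindex_commute (h := fun mu : {ffun I -> _} => (mu - d)%R) (F := fun mu => F mu ^+ m.-1)).
- rewrite -prodgM_commute => [|mu nu _ _]; last exact: (cF mu _ 1%N).
  by rewrite big1 // => mu _;
    rewrite -expgS prednK // /F -expgnA mulnC expgnA exp_h expg1n.
- by move=> mu nu; apply: cF.
exact: GRing.addIr.
Qed.

End Kernel.

Lemma kern_primes0 n m : 1 < n -> kern (n := n) m (primes n) 0%R = 1%N.
Proof.
move=> n_gt1; apply: kern0; rewrite ?primes_uniq // => q /=;
  by rewrite mem_primes => /and3P[].
Qed.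

(** * Lower central series and commutators *)

Section LowerCentral.

Variable gT : finGroupType.
Implicit Types G : {group gT}.

Lemma three_subgroup_mod (H K L N : {group gT}) :
    H \subset 'N(N) -> K \subset 'N(N) -> L \subset 'N(N) ->
    [~: H, K, L] \subset N -> [~: K, L, H] \subset N ->
  [~: L, H, K] \subset N.
Proof.
move=> nH nK nL; have nR (X Y : {group gT}) : X \subset 'N(N) ->
  Y \subset 'N(N) ->
    [~: X, Y] \subset 'N(N).
  by move=> nX nY; apply: subset_trans (commg_sub _ _) _; rewrite join_subG nX.
have subN (X Y Z : {group gT}) :
    X \subset 'N(N) -> Y \subset 'N(N) -> Z \subset 'N(N) ->
    ([~: X, Y, Z] \subset N) = ([~: X / N, Y / N, Z / N] == 1).
  move=> nX nY nZ; rewrite -quotient_sub1 ?nR //= !quotientR ?nR //=.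
  by rewrite subG1.
rewrite !subN // => /eqP HKL /eqP KLH.
by apply/eqP; apply: three_subgroup.
Qed.

Lemma lcn_comm G i j : 0 < i -> 0 < j ->
  [~: 'L_i(G), 'L_j(G)] \subset 'L_(i + j)(G).
Proof.
case: i j => // i [//|j] _ _; elim: j i => [|j IHj] i;
  first by rewrite addn1 lcnSnS.
have nL k : 'L_k(G) \subset 'N('L_(i.+1 + j.+2)(G)).
  exact: subset_trans (lcn_sub _ _) (lcn_norm _ _).
rewrite commGC lcnSn; apply: (@three_subgroup_mod G _ 'L_j.+1(G));
  rewrite ?nL ?lcn_norm //.
  by rewrite commGC [[~: G, _]]commGC -lcnSn commGC addnS -addSn IHj.
rewrite addnS; apply: subset_trans (lcnSnS _ _); exact: commSg (IHj i).
Qed.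

(** L_(k+1) is central modulo L_(k+2), and L_2 commutes with L_k modulo
   L_(k+2). *)
Lemma commg_congr_lcn G k u v y z :
    0 < k -> u \in 'L_k(G) -> v \in 'L_k(G) -> y \in G -> z \in G ->
    u^-1 * v \in 'L_k.+1(G) -> y^-1 * z \in 'L_2(G) ->
  [~ u, y]^-1 * [~ v, z] \in 'L_k.+2(G).
Proof.
move=> k_gt0 Lu Lv Gy Gz; rewrite -{2}[v](mulVKg u) -{2}[z](mulVKg y).
set a := u^-1 * v; set w := y^-1 * z => La Lw; set N := 'L_k.+2(G)%G.
have Lv' : u * a \in 'L_k(G) by rewrite mulVKg.
have sLG j : {subset 'L_j(G) <= G} by apply/subsetP/lcn_sub.
have nN x : x \in G -> x \in 'N(N) by apply/subsetP/lcn_norm.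
have comN i j b c : 0 < i -> 0 < j -> (i + j = k.+2)%N -> b \in 'L_i(G) ->
    c \in 'L_j(G) -> commute (coset N b) (coset N c).
  move=> i0 j0 ij Lb Lc; apply/commgP;
    rewrite -morphR ?nN ?(sLG _ _ Lb) ?(sLG _ _ Lc) //=.
  apply/eqP/coset_id; rewrite /N /= -ij; apply: (subsetP (lcn_comm G i0 j0)).
  exact: mem_commg.
clearbody a w; have Gu := sLG _ _ Lu; have Ga := sLG _ _ La;
  have Gw := sLG _ _ Lw.
apply: (@coset_idr _ N); first by apply: nN; rewrite !(groupM, groupV, groupR).
have mM b c : b \in G -> c \in G -> coset N (b * c) = coset N b * coset N c.
  by move=> Gb Gc; rewrite morphM ?nN.
have mV b : b \in G -> coset N b^-1 = (coset N b)^-1.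
  by move=> Gb; rewrite morphV ?nN.
have mR b c : b \in G -> c \in G -> coset N [~ b, c] = [~ coset N b, coset N c].
  by move=> Gb Gc; rewrite morphR ?nN.
rewrite mM ?mV ?mR ?(mM u) ?(mM y) ?(groupM, groupV, groupR) //.
have cvw := comN k 2%N _ _ k_gt0 isT (addn2 k) Lv' Lw.
have cay := comN k.+1 1%N _ _ isT isT (addn1 _) La Gy.
have Luy : [~ u, y] \in 'L_k.+1(G).
  by apply: (subsetP (lcnSnS _ _)); apply: mem_commg.
have cauy := comN k.+1 1%N _ _ isT isT (addn1 _) Luy Ga.
have cwuy := comN k.+1 1%N _ _ isT isT (addn1 _) Luy Gw.
rewrite mM // in cvw; rewrite mR // in cauy cwuy.
rewrite commgMJ (eqP (introT commgP cvw)) mul1g commMgJ.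
rewrite (eqP (introT commgP cay)) mulg1.
by rewrite (conjg_fixP (introT commgP cauy)) (conjg_fixP (introT commgP cwuy))
  mulVg.
Qed.

(** So in a group of class c the left-normed commutators of weight c only
   depend on their entries modulo the derived subgroup. *)
Lemma lnc_congr_lcn G (I : eqType) (l : seq I) (f h : I -> gT) x y :
    x \in G -> y \in G -> (forall i, f i \in G) -> (forall i, h i \in G) ->
    x^-1 * y \in 'L_2(G) -> (forall i, (f i)^-1 * h i \in 'L_2(G)) ->
  (lnc x [seq f i | i <- l])^-1 * lnc y [seq h i | i <- l] \in
    'L_(size l).+2(G).
Proof.
move=> Gx Gy Gf Gh Lxy Lfh; elim/last_ind: l => [//|l i IHl].
rewrite size_rcons !map_rcons !lnc_rcons commg_congr_lcn //.
  by rewrite -(size_map f l) mem_lnc_lcn // => _ /mapP[j _ ->].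
by rewrite -(size_map h l) mem_lnc_lcn // => _ /mapP[j _ ->].
Qed.

End LowerCentral.

(** * Abelianisation *)

Section Abelianisation.

Variable A : finGroupType.

Definition abmap : A -> coset_of 'L_2([set: A]) := coset 'L_2([set: A]).

Lemma mem_lcn_norm k (x : A) : x \in 'N('L_k([set: A])).
Proof. by apply: (subsetP (lcn_norm k [set: A])); rewrite inE. Qed.

Lemma abmapM : {morph abmap : x y / x * y}.
Proof. by move=> x y; rewrite /abmap morphM ?mem_lcn_norm. Qed.

Lemma abmap_eq x y : abmap x = abmap y -> x^-1 * y \in 'L_2([set: A]).
Proof.
move=> eqxy; apply: coset_idr; first exact: mem_lcn_norm.
by rewrite -/(abmap _) abmapM (mmorphV abmapM) eqxy mulVg.
Qed.

Lemma abmap_commute (u v : coset_of 'L_2([set: A])) : commute u v.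
Proof.
have [x _ ->] := cosetP u; have [y _ ->] := cosetP v.
apply/commgP; rewrite -morphR ?mem_lcn_norm //=; apply/eqP/coset_id.
by rewrite lcnSn mem_commg ?inE.
Qed.

Lemma abmap_exponent (u : coset_of 'L_2([set: A])) : u ^+ exponent [set: A] = 1.
Proof.
have [x _ ->] := cosetP u.
by rewrite -[coset _ x]/(abmap x) -(mmorphX abmapM) expg_exponent ?inE
  ?(mmorph1 abmapM).
Qed.

End Abelianisation.

Section WreathBase.

Variables A Q : finGroupType.

Lemma wtop_prod (I : Type) (r : seq I) (F : I -> wreath A Q) :
  (forall i, wtop (F i) = 1) -> wtop (\prod_(i <- r) F i) = 1.
Proof. by move=> F1; rewrite (big_morph _ (@wtopM A Q) (@wtop1 A Q)) big1. Qed.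

Lemma wbase_prod (I : Type) (r : seq I) (F : I -> wreath A Q) x :
  (forall i, wtop (F i) = 1) ->
  wbase (\prod_(i <- r) F i) x = \prod_(i <- r) wbase (F i) x.
Proof.
move=> F1; elim: r => [|i r IHr]; first by rewrite !big_nil wbase1.
by rewrite !big_cons wbaseM F1 mulg1 IHr.
Qed.

Lemma wbaseX (u : wreath A Q) k x : wtop u = 1 ->
  wbase (u ^+ k) x = wbase u x ^+ k.
Proof.
by move=> u1; have := @wbase_prod _ (iota 0 k) (fun=> u) x (fun=> u1);
  rewrite !big_const_seq !count_predT !size_iota !iter_mulg_1.
Qed.

Lemma wtopJ (u v : wreath A Q) : wtop (u ^ v) = wtop u ^ wtop v.
Proof. by []. Qed.

Lemma wtopX (u : wreath A Q) k : wtop (u ^+ k) = wtop u ^+ k.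
Proof. exact: (mmorphX (@wtopM A Q)). Qed.

End WreathBase.

(** * A law detecting the rank of the active group *)

Section RankLaw.

Variables (c n : nat) (G : 'Z_n -> nat).
Hypothesis n_gt1 : 1 < n.

Local Notation M := {ffun 'I_c -> 'Z_n}.

(** The letters are y_i = (i, true) and t_i = (i, false). The word is an
   average of the conjugates of y_i ^ n over the group generated by the t_j,
   weighted by G in the direction of t_i; the power n moves y_i to the base
   group. *)
Definition slot (i : 'I_c) : gword ('I_c * bool) :=
  wprod (index_enum M) (fun mu =>
    wpow (wconj (wpow (wvar (i, true)) n)
                (wprod (index_enum 'I_c) (fun j => wpow (wvar (j, false)) (mu j))))
         (G (mu i))).

Variables A Q : finGroupType.
Hypothesis expQ : forall x : Q, x ^+ n = 1.
Variable s : 'I_c * bool -> wreath A Q.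

Local Notation b := (fun j => wtop (s (j, false))).

Lemma wtop_slot i : wtop (geval s (slot i)) = 1.
Proof.
rewrite geval_prod wtop_prod // => mu;
  rewrite geval_pow geval_conj geval_pow geval_var.
by rewrite wtopX wtopJ wtopX expQ conj1g expg1n.
Qed.

(** Modulo the derived subgroup, conjugation by base elements is trivial, so
   only the active components of the t_j matter. *)
Lemma wbase_slot i x :
  abmap (wbase (geval s (slot i)) x) =
    \prod_(mu : M) abmap (wbase (s (i, true) ^+ n) (x * (pw b mu)^-1)) ^+ G
      (mu i).
Proof.
rewrite geval_prod wbase_prod => [|mu]; last first.
  rewrite geval_pow geval_conj geval_pow geval_var.
  by rewrite wtopX wtopJ wtopX expQ conj1g expg1n.
rewrite (big_morph _ (@abmapM A) (mmorph1 (@abmapM A))); apply: eq_bigr => mu _.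
rewrite geval_pow geval_conj geval_pow geval_var.
have y1: wtop (s (i, true) ^+ n) = 1 by rewrite wtopX expQ.
rewrite [in LHS]wbaseX; last first.
  by rewrite wtopJ y1 conj1g.
rewrite (mmorphX (@abmapM A)) wbaseJ //; congr (_ ^+ _).
have ->: wtop (geval s (wprod (index_enum 'I_c) (fun j => wpow (wvar (j, false)) (mu j)))) = pw b mu.
  rewrite geval_prod (big_morph _ (@wtopM A Q) (@wtop1 A Q));
    apply: eq_bigr => j _.
  by rewrite geval_pow geval_var wtopX.
set z := _ * _; rewrite conjgE !abmapM (mmorphV (@abmapM A)).
by rewrite [_ * abmap (wbase (geval s _) z)]abmap_commute mulKg.
Qed.

End RankLaw.

(** * Necessity of the rank condition *)

Section Rank.

Variables A B : finGroupType.
Local Notation n := (exponent [set: B]).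
Local Notation m := (exponent [set: A]).
Local Notation c := (nil_class [set: A]).
Local Notation G := (kern (n := n) m (primes n)).
Hypotheses (nilA : nilpotent [set: A]) (abB : abelian [set: B]).
Hypotheses (ntA : [set: A] != 1) (ntB : [set: B] != 1).
Hypothesis coAB : coprime m n.

Lemma exponent_gt1 (gT : finGroupType) : [set: gT] != 1 ->
  1 < exponent [set: gT].
Proof.
move=> ntG; have:= exponent_gt0 [set: gT]; rewrite leq_eqVlt => /predU1P[e1|//].
by rewrite trivg_exponent -e1 dvdn1 in ntG.
Qed.

Let n_gt1 : 1 < n. Proof. exact: exponent_gt1. Qed.

Lemma active_comm (x y : B) : commute x y.
Proof. by apply: (centsP abB); rewrite inE. Qed.

Lemma active_exponent (x : B) : x ^+ n = 1.
Proof. by rewrite expg_exponent ?inE. Qed.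

(** Its weight is the class of A, so by lnc_congr_lcn the slots only matter
   modulo the derived subgroup. *)
Definition rank_word (i0 : 'I_c) : gword ('I_c * bool) :=
  wlnc (slot G i0) [seq slot G i | i <- enum (predC1 i0)].

Lemma size_predC1_class (i0 : 'I_c) : size (enum (predC1 i0)) = c.-1.
Proof. by rewrite -cardE cardC1 card_ord. Qed.

Section RankWordEval.

Variables (Q : finGroupType) (expQ : forall x : Q, x ^+ n = 1).
Variables (s : 'I_c * bool -> wreath A Q) (i0 : 'I_c).

Local Notation F i x := (wbase (geval s (slot G i)) x).

Lemma wbase_rank_word x :
  wbase (geval s (rank_word i0)) x =
    lnc (F i0 x) [seq F i x | i <- enum (predC1 i0)].
Proof.
pose f i : {dffun Q -> A} := [ffun y => F i y].
have Ef i : geval s (slot G i) = base_elt (f i) by apply/base_eltE/wtop_slot.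
have ->: geval s (rank_word i0) =
    base_elt (lnc (f i0) [seq f i | i <- enum (predC1 i0)]).
  rewrite geval_lnc (lnc_morph _ _ (@base_eltM A Q)) -!map_comp Ef.
  by congr lnc; apply: eq_map => i; apply: Ef.
rewrite wbase_mk (lnc_morph (f := fun h : {dffun Q -> A} => h x)) => [|? ?];
  last by rewrite ffunE.
by rewrite -map_comp /f ffunE; congr lnc; apply: eq_map => i /=; rewrite ffunE.
Qed.

Lemma rank_word_congr x (h : 'I_c -> A) :
    (forall i, abmap (F i x) = abmap (h i)) ->
  wbase (geval s (rank_word i0)) x =
    lnc (h i0) [seq h i | i <- enum (predC1 i0)].
Proof.
move=> eqh; rewrite wbase_rank_word.
have := @lnc_congr_lcn A [set: A] _ (enum (predC1 i0)) (fun i => F i x) h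
  (F i0 x) (h i0).
rewrite size_predC1_class prednK; last by case: c i0 => [[]|].
have -> : 'L_c.+1([set: A]) = 1 by apply/lcn_nil_classP.
move=> inL1; apply/invg_inj/divg1_eq; rewrite invgK; apply/set1P.
by apply: inL1; rewrite ?inE //; try (by move=> i; rewrite inE); try move=> i;
  apply/abmap_eq/eqh.
Qed.

End RankWordEval.

(** Translation by the relation d leaves the conjugates in the i-th slot
   unchanged, so prod_kern_invariant kills this slot modulo the derived
   subgroup. *)
Lemma rank_word_law (i0 : 'I_c) (s : 'I_c * bool -> wreath A B) :
    (forall b : 'I_c -> B, exists i q (d : {ffun 'I_c -> 'Z_n}),
       [/\ q \in primes n, d i = (n %/ q)%:R%R & pw b d = 1]) ->
  geval s (rank_word i0) = 1.
Proof.
move=> dep; pose b j := wtop (s (j, false)).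
have [i [q [d [q_n di bd]]]] := dep b.
have Fi x : abmap (wbase (geval s (slot G i)) x) = 1.
  rewrite wbase_slot //; last exact: active_exponent.
apply: (prod_kern_invariant (m := m) (lam := fun mu : {ffun 'I_c -> 'Z_n} => mu i) (d := d) _ _ _ _ q_n di).
  - exact: exponent_gt0.
  - by move=> *; apply: abmap_commute.
  - by move=> *; apply: abmap_exponent.
  - by move=> mu nu; rewrite ffunE.
  by move=> mu; rewrite pwD ?bd ?mulg1 //;
    [apply: active_comm | apply: active_exponent].
apply: wreath_eq => [|x].
  rewrite geval_lnc (lnc_morph _ _ (@wtopM A B)) wtop_slot ?lnc1g //.
  exact: active_exponent.
rewrite wbase1 (@rank_word_congr _ active_exponent _ _ _ (fun j => if j == i then 1 else wbase (geval s (slot G j)) x)).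
  apply: lnc_mem1; rewrite inE; have [->|neq] := eqVneq i0 i;
    first by rewrite !eqxx.
  by apply/orP; right; apply/mapP; exists i;
    rewrite ?mem_enum ?inE 1?eq_sym ?eqxx.
by move=> j; case: eqP => // ->; rewrite Fi (mmorph1 (@abmapM A)).
Qed.

(** A nonzero vector of the kernel has a multiple with an entry n/q. *)
Lemma independent_embedding (b : 'I_c -> B) :
    (forall i q (d : {ffun 'I_c -> 'Z_n}),
       q \in primes n -> d i = (n %/ q)%:R%R -> pw b d <> 1) ->
  exists H : {group B}, H \isog cyclic_power n c.
Proof.
move=> ind; pose f (x : {dffun 'I_c -> 'Z_n}) := pw b x.
have fM : {in [set: {dffun 'I_c -> 'Z_n}] &, {morph f : x y / x * y}}.
  move=> x y _ _; rewrite /f -(pwD n_gt1 active_comm active_exponent).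
  by congr pw; apply/ffunP=> i; rewrite !ffunE.
pose fm := Morphism fM.
exists (fm @* [set: {dffun 'I_c -> 'Z_n}])%G; rewrite cyclic_powerT // isog_sym.
apply: (sub_isog (f := fm)) => //; apply/subsetP=> x /morphpreP[_ /set1P fx1].
rewrite inE; apply: contraT => nz_x; exfalso.
have [i nz_xi] : exists i, x i != 0%R.
  apply: NNPP => no_i; case/eqP: nz_x; apply/ffunP=> i; rewrite ffunE.
  by apply/eqP/negPn/negP => nz_xi; case: no_i; exists i.
have [q [l [q_n El]]] := Zn_multiple_step n_gt1 nz_xi.
apply: (ind i q (GRing.natmul (x : {ffun 'I_c -> 'Z_n}) l)) => //.
  by rewrite -El; elim: (l) => [|k IHk];
    rewrite ?GRing.mulr0n ?GRing.mulrS ffunE // IHk.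
rewrite (pwMn n_gt1 active_comm active_exponent).
by rewrite -/(f x) [f x]fx1 expg1n.
Qed.

Lemma coprime_card_zero_coord (i : 'I_c) :
  coprime m #|[pred mu : {ffun 'I_c -> 'Z_n} | mu i == 0%R]|.
Proof.
pose F (j : 'I_c) : pred 'Z_n := if j == i then pred1 0%R else predT.
have -> : #|[pred mu : {ffun 'I_c -> 'Z_n} | mu i == 0%R]| = #|family F|.
  apply: eq_card => mu; apply/idP/familyP => [/= mui j | /(_ i)].
    by rewrite /F; case: eqP => // ->.
  by rewrite /F eqxx.
rewrite card_family foldrE big_map; elim/big_rec: _ => [|j k _ co_k].
  exact: coprimen1.
rewrite coprimeMr co_k andbT /F; case: eqP => _;
  first by rewrite card1 coprimen1.
by rewrite card_ord Zp_cast.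
Qed.

(** Take independent elements t_j of order n, and let y_i be the function on
   the active group which is a'_i where the i-th coordinate is trivial and 1
   elsewhere. At the point 1 the i-th slot only sees the vectors mu with mu i
   = 0, where the kernel is 1. So it takes the value a'_i ^ N, with N coprime
   to the exponent of A, and this can be made an arbitrary element of A. *)
Lemma rank_word_nonlaw (i0 : 'I_c) :
  exists s : 'I_c * bool -> wreath A {dffun 'I_c -> B},
    geval s (rank_word i0) <> 1.
Proof.
pose Q : finGroupType := {dffun 'I_c -> B}.
have coordM i : {morph (fun x : Q => x i) : x y / x * y} by move=> x y;
  rewrite ffunE.
have expQ (x : Q) : x ^+ n = 1.
  by apply/ffunP=> i; rewrite (mmorphX (coordM i)) ffunE active_exponent.
have [b0 _ ob0] := exponent_witness (abelian_nil abB).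
have [x [r [sz_r lnc_r]]] : exists (x : A) r, size r = c.-1 /\ lnc x r <> 1.
  apply: NNPP => no_r; have /ucn_nil_classP : 'Z_c.-1([set: A]) = [set: A].
    apply: lnc_trivial_nil => x r sz_r; apply: NNPP => r1; case: no_r.
    by exists x, r.
  by move=> /(_ nilA); case: c i0 => [[]|k _] //=; rewrite ltnn.
pose a i := if i == i0 then x else nth 1 r (index i (enum (predC1 i0))).
have lnc_a : lnc (a i0) [seq a i | i <- enum (predC1 i0)] <> 1.
  suffices -> : [seq a i | i <- enum (predC1 i0)] = r by rewrite /a eqxx.
  apply: (@eq_from_nth _ 1); rewrite size_map size_predC1_class // => k lt_k.
  rewrite (nth_map i0) ?size_predC1_class // /a index_uniq ?enum_uniq
    ?size_predC1_class //.
  case: eqP => // Ei; have : i0 \in enum (predC1 i0).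
    by rewrite -{1}Ei mem_nth // size_predC1_class.
  by rewrite mem_enum inE eqxx.
pose N i := (n * #|[pred mu : {ffun 'I_c -> 'Z_n} | mu i == 0%R]|)%N.
have /fin_all_exists[a' Ea'] i : exists y, y ^+ N i = a i.
  by apply: coprime_root; rewrite coprimeMr coAB coprime_card_zero_coord.
pose f i : {dffun Q -> A} := [ffun y : Q => if y i == 1 then a' i else 1].
pose t i : Q := dfung1 (gT := fun=> B) (i := i) b0.
pose s (l : 'I_c * bool) : wreath A Q := if l.2 then base_elt (f l.1) else
  active_elt A (t l.1).
exists s => /(congr1 (fun u => wbase u 1)).
rewrite wbase1 (@rank_word_congr _ expQ _ _ _ a) // => i.
rewrite wbase_slot // -Ea' (mmorphX (@abmapM A)) expgnA -prodg_const
  [RHS]big_mkcond /=.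
apply: eq_bigr => mu _; rewrite mul1g -(mmorphX (@base_eltM A Q)) wbase_mk.
have -> : (f i ^+ n) (pw (fun j => wtop (s (j, false))) mu)^-1 =
    if mu i == 0%R then a' i ^+ n else 1.
  have fM y : {morph (fun h : {dffun Q -> A} => h y) : g h / g * h}.
    by move=> g h; rewrite ffunE.
  rewrite (mmorphX (fM _)) ffunE (mmorphV (coordM i)) invg_eq1.
  rewrite prodg_ffun (@prodg_single _ _ _ i) => [|j neq]; last first.
    by rewrite (mmorphX (coordM i)) dfung1_dflt // expg1n.
  rewrite (mmorphX (coordM i)) dfung1_id -order_dvdn -ob0.
  have -> : (n %| mu i) = (mu i == 0%R).
    have lt_mu : mu i < n by rewrite -[X in _ < X](Zp_cast n_gt1).
    by rewrite -val_eqE /= -{2}(modn_small lt_mu).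
  by case: ifP => // _; rewrite expg1n.
rewrite inE; case: eqP => [-> | _];
  last by rewrite (mmorph1 (@abmapM A)) expg1n.
by rewrite kern_primes0 // expg1 (mmorphX (@abmapM A)).
Qed.

Lemma product_rank :
    (forall Q : finGroupType, var B Q -> var (wreath A B) (wreath A Q)) ->
  exists H : {group B}, H \isog cyclic_power n c.
Proof.
move=> varW; have c_gt0 : 0 < c by rewrite lt0n nil_class0.
pose i0 := Ordinal c_gt0; apply: NNPP => noH.
have [s []] := rank_word_nonlaw i0.
have varE : var (wreath A B) (wreath A {dffun 'I_c -> B}).
  by apply: varW; apply: var_dffun.
apply: (var_law varE) => s' {s}.
apply: rank_word_law => b; apply: NNPP => no_rel; case: noH.
apply: (@independent_embedding b) => i q d q_n di bd.
by case: no_rel; exists i, q, d.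
Qed.

End Rank.

(** * Words of a nilpotent group are determined by few factors *)

Section CrossEffect.

Variables (A : finGroupType) (J : finType).
Local Notation cube := {dffun {set J} -> A}.
Local Notation L k := ('L_k([set: A])).

(** A function of subsets of J, as arising from a product indexed by J by
   deleting factors. In the next definitions the entries of a face of S lie in
   L_|S|: these face groups generate the cube group of A with its lower
   central filtration. *)
Definition face (S : {set J}) (g : A) : cube :=
  [ffun T : {set J} => if S \subset T then g else 1].

Lemma faceM S : {morph face S : g h / g * h}.
Proof. by move=> g h; apply/ffunP=> T; rewrite !ffunE; case: ifP;
  rewrite ?mulg1. Qed.

Lemma faceR S T g h : [~ face S g, face T h] = face (S :|: T) [~ g, h].
Proof.
apply/ffunP=> X; rewrite !ffunE subUset.
by case: (S \subset X); case: (T \subset X);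
  rewrite /= ?invg1 ?mul1g ?mulg1 ?mulVg.
Qed.

(** A numbering of the subsets that strictly increases with inclusion. *)
Definition level (S : {set J}) : nat :=
  (#|S| * #|{: {set J}}| + enum_rank S)%N.

Lemma level_inj : injective level.
Proof.
move=> S T; rewrite /level => eqST; apply: enum_rank_inj; apply: val_inj => /=.
have := congr1 (modn^~ #|{: {set J}}|) eqST.
by rewrite !modnMDl !modn_small.
Qed.

Lemma leq_level (S T : {set J}) : #|S| < #|T| -> level S < level T.
Proof.
move=> ltST; rewrite /level; apply: (@leq_trans (#|S|.+1 * #|{: {set J}}|)).
  by rewrite mulSn [X in _ < X]addnC ltn_add2l.
by apply: leq_trans (leq_addr _ _); rewrite leq_mul2r ltST orbT.
Qed.

Lemma level_subset (S T : {set J}) : S \subset T -> S != T -> level S < level T.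
Proof. by move=> sST neqST;
  rewrite leq_level // proper_card // properEneq neqST. Qed.

Lemma level_nonempty (S : {set J}) : #|{: {set J}}| <= level S -> 0 < #|S|.
Proof.
rewrite lt0n; apply: contraTneq => S0; rewrite /level S0 mul0n add0n.
by rewrite -ltnNge.
Qed.

Definition tail_gens k : {set cube} :=
  [set face p.1 p.2 | p : {set J} * A in
     [pred p | (k <= level p.1) && (p.2 \in L #|p.1|)]].

Definition tail k : {group cube} := <<tail_gens k>>%G.

Lemma mem_tail k S g : k <= level S -> g \in L #|S| -> face S g \in tail k.
Proof.
move=> le_k Lg; apply/mem_gen/imsetP.
by exists (S, g); rewrite // inE le_k.
Qed.

Lemma tail_ind k (H : {group cube}) :
    (forall S g, k <= level S -> g \in L #|S| -> face S g \in H) ->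
  tail k \subset H.
Proof.
move=> Hf; rewrite gen_subG;
  apply/subsetP=> _ /imsetP[[S g] /andP[/= le_k Lg] ->].
exact: Hf.
Qed.

(** Removing the first generator of a tail: since [face S g, face T h] is
   supported over the union of S and T, the first face group normalizes the
   rest of the tail, whose elements are 1 at S. *)
Lemma tail_step k (u : cube) : #|{: {set J}}| <= k ->
    u \in tail k -> (forall S, level S = k -> u S = 1) ->
  u \in tail k.+1.
Proof.
move=> le_k; have [[S lvS] | no_S] := excluded_middle_informative
  (exists S, level S = k); last first.
  move=> tu _; apply: subsetP tu; apply: tail_ind => S g le_kS Lg.
  apply: mem_tail => //; rewrite ltn_neqAle le_kS andbT.
  by apply/eqP => lvS; case: no_S; exists S.
move=> tu /(_ S lvS) uS1.
have S_gt0: 0 < #|S| by apply: level_nonempty; rewrite lvS.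
pose F := Morphism (in2W (faceM S) : {in [set: A] &, _}).
pose FS := F @* L #|S|.
have nFS : FS \subset 'N(tail k.+1).
  apply/subsetP=> _ /morphimP[g _ Lg ->]; rewrite inE -genJ gen_subG.
  apply/subsetP=> _ /imsetP[_ /imsetP[[T h] /andP[/= lt_kT Lh] ->] ->].
  rewrite conjg_mulR /= faceR groupM ?mem_tail //.
    by have [<- // | /(level_subset (subsetUl T S))] := eqVneq T (T :|: S);
      apply: ltn_trans.
  have: [~ h, g] \in L (#|T| + #|S|).
    have T_gt0: 0 < #|T| by apply/level_nonempty/(leq_trans le_k)/ltnW.
    by apply: (subsetP (lcn_comm _ T_gt0 S_gt0)); apply: mem_commg.
  by apply/subsetP/lcn_sub_leq; rewrite cardsU leq_subr.
have: u \in FS <*> tail k.+1.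
  apply: subsetP tu; apply: tail_ind => T g;
    rewrite leq_eqVlt => /predU1P[kT|lt_kT] Lg.
    have ST : S = T by apply: level_inj; rewrite lvS.
    rewrite -ST in Lg *.
    by apply: (subsetP (joing_subl _ _)); apply: (mem_morphim F); rewrite ?inE.
  by apply: (subsetP (joing_subr _ _)); apply: mem_tail.
rewrite norm_joinEl // => /mulsgP[_ r /morphimP[g _ Lg ->] tr Eu].
have rS1: r S = 1.
  suffices: r \in 'ker (dffun_morphism (fun=> A) S) by move/mker.
  apply: subsetP tr; apply: tail_ind => T h lt_kT _; apply/kerP;
    rewrite ?inE //= ffunE.
  case: ifP => // sTS; exfalso; have [eTS | neqTS] := eqVneq T S.
    by rewrite eTS lvS ltnn in lt_kT.
  by have := level_subset sTS neqTS; rewrite lvS ltnNge ltnW.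
by move: uS1; rewrite Eu mulg_ffun rS1 mulg1 /= ffunE subxx => ->;
  rewrite mmorph1 ?mul1g //; apply: faceM.
Qed.

(** By tail_step u lies in all tails up to the level where the sizes exceed
   the class, and there the entries are trivial. *)
Lemma cube_small_support (u : cube) :
    nilpotent [set: A] -> u \in tail #|{: {set J}}| ->
    (forall S : {set J}, #|S| <= nil_class [set: A] -> u S = 1) ->
  u = 1.
Proof.
set c := nil_class _; set K := #|{: {set J}}| => nilA tu u1.
have{tu} tu d : K + d <= K * c.+1 -> u \in tail (K + d).
  elim: d => [|d IHd] le_d; first by rewrite addn0.
  rewrite addnS; apply: tail_step => [||S lvS]; first exact: leq_addr.
    by apply: IHd; apply: ltnW; rewrite -addnS.
  apply: u1; rewrite -ltnS;
    have K_gt0 : 0 < K by apply: leq_trans (ltn_ord (enum_rank S)).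
  rewrite -(ltn_pmul2r K_gt0) (mulnC c.+1); apply: leq_trans le_d.
  by rewrite addnS ltnS -lvS leq_addr.
have le_K : K <= K * c.+1 by rewrite mulnS leq_addr.
have := tu (K * c.+1 - K)%N; rewrite subnKC // => /(_ (leqnn _)) tu'.
apply/set1P; apply: subsetP tu'; apply: (tail_ind (H := 1%G)) => S g le_S Lg.
have lt_c : c < #|S|.
  rewrite ltnNge; apply/negP=> le_c; move: le_S; rewrite leqNgt /level -/K.
  by rewrite mulnS [X in _ < X]addnC -addnS leq_add
    ?ltn_ord // mulnC leq_mul2l le_c orbT.
have L1 : L c.+1 = 1 by apply/lcn_nil_classP.
have: g \in L c.+1 by apply: (subsetP (lcn_sub_leq _ lt_c)).
by rewrite L1 => /set1P->; rewrite mmorph1 ?set11 //; apply: faceM.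
Qed.

(** The values of v at all subproducts form an element of the group generated
   by the faces of nonempty sets, and such an element is determined by its
   values at the sets of size at most the nilpotency class. *)
Lemma geval_few_factors (X : Type) (v : gword X) (r : seq J) (f : J -> X -> A) :
    nilpotent [set: A] ->
    (forall S : {set J}, #|S| <= nil_class [set: A] ->
       geval (fun x => \prod_(j <- r | j \in S) f j x) v = 1) ->
  geval (fun x => \prod_(j <- r) f j x) v = 1.
Proof.
move=> nilA v1; pose s x : cube := \prod_(j <- r) face [set j] (f j x).
have evS (S : {set J}) :
    geval s v S = geval (fun x => \prod_(j <- r | j \in S) f j x) v.
  rewrite (geval_morph (f := fun u : cube => u S)) => [|? ?];
    last by rewrite ffunE.
  apply: eq_geval => x; rewrite /= prodg_ffun [RHS]big_mkcond.
  by apply: eq_bigr => j _; rewrite ffunE sub1set.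
have: geval s v = 1.
  apply: cube_small_support => // [|S /v1]; last by rewrite evS.
  rewrite /geval; apply: group_prod => -[x b] _ /=.
  have sx : s x \in tail #|{: {set J}}|.
    apply: group_prod => j _; apply: mem_tail; last by rewrite cards1 inE.
    by rewrite /level cards1 mul1n leq_addr.
  by case: b; rewrite ?groupV.
move/(congr1 (fun u : cube => u [set: J])); rewrite evS ffunE => E1;
  rewrite -[RHS]E1.
by apply: eq_geval => x; apply: eq_bigl => j; rewrite inE.
Qed.

End CrossEffect.

(** * Functions factoring through characters *)

Section Characters.

Variables (A : finGroupType) (n : nat) (I K : finType).
Hypotheses (n_gt1 : 1 < n) (coAn : coprime (exponent [set: A]) n).

Local Notation M := {ffun K -> 'Z_n}.
Local Notation G := (kern (n := n) (exponent [set: A]) (primes n)).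

Definition dot (phi q : M) : 'Z_n := (\sum_k phi k * q k)%R.

Lemma dotD phi q q' : dot phi (q + q')%R = (dot phi q + dot phi q')%R.
Proof. by rewrite -big_split; apply: eq_bigr => k _;
  rewrite ffunE GRing.mulrDr. Qed.

Lemma dotDl phi phi' q : dot (phi + phi')%R q = (dot phi q + dot phi' q)%R.
Proof. by rewrite -big_split; apply: eq_bigr => k _;
  rewrite ffunE GRing.mulrDl. Qed.

(** The delta function at 0 as a combination of characters, without roots of
   unity: if q is nonzero, some d pairs with it to n/p, and the kernel
   annihilates constants. *)
Lemma prod_kern_dot (a : A) (q : M) :
  \prod_(phi : M) a ^+ G (dot phi q) = if q == 0%R then a ^+ #|{: M}| else 1.
Proof.
case: eqP => [-> | /eqP nz_q].
  rewrite (eq_bigr (fun=> a)) => [|phi _]; last first.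
    rewrite /dot big1 => [|k _]; last by rewrite ffunE GRing.mulr0.
    by rewrite kern_primes0.
  by rewrite -[RHS]prodg_const.
have [k nz_qk] : exists k, q k != 0%R.
  apply: NNPP => no_k; case/eqP: nz_q; apply/ffunP=> k; rewrite ffunE.
  by apply/eqP/negPn/negP => nz_qk; case: no_k; exists k.
have [p [l [p_n El]]] := Zn_multiple_step n_gt1 nz_qk.
pose d : M := [ffun j => if j == k then l%:R else 0]%R.
have dq : dot d q = (n %/ p)%:R%R.
  rewrite /dot (bigD1 k) //= big1 => [|j /negPf neq];
    last by rewrite ffunE neq GRing.mul0r.
  by rewrite ffunE eqxx GRing.addr0 GRing.mulr_natl.
apply: (prod_kern_invariant (m := exponent [set: A]) (lam := dot^~ q) (d := d) (h := fun=> a) _ _ _ _ p_n dq) => //.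
- exact: exponent_gt0.
- by move=> _; rewrite expg_exponent ?inE.
by move=> phi phi'; apply: dotDl.
Qed.

(** The factor #|M| of prod_kern_dot is removed by taking a root of a. *)
Lemma char_delta (a : A) : exists a' : A, forall q : M,
  \prod_(phi : M) a' ^+ G (dot phi q) = if q == 0%R then a else 1.
Proof.
have [|a' Ea'] := @coprime_root A a #|{: M}|.
  by rewrite card_ffun card_ord Zp_cast // coprimeXr.
by exists a' => q; rewrite prod_kern_dot Ea'.
Qed.

(** Multiply the translates of the delta functions given by char_delta. The
   factors are functions of one character of M each. *)
Lemma char_expansion (f : I * M -> A) :
  exists (F : (I * M) * M -> I * M -> A) (r : seq ((I * M) * M)),
    (forall j i q q', dot j.2 q = dot j.2 q' -> F j (i, q) = F j (i, q')) /\
    (forall x, \prod_(j <- r) F j x = f x).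
Proof.
have /fin_all_exists[a Ea] x := char_delta (f x).
exists (fun j x => if x.1 == j.1.1 then a j.1 ^+ G (dot j.2 (x.2 - j.1.2)%R) else 1).
exists [seq (x, phi) | x <- index_enum (I * M)%type, phi <- index_enum M];
  split.
  move=> [[i0 q0] phi] i q q' /= eqq; case: ifP => // _.
  by rewrite !dotD eqq.
move=> [i q]; rewrite big_allpairs /=.
transitivity (\prod_(x : I * M) if (i == x.1) && (q - x.2 == 0)%R then f x else 1).
  apply: eq_bigr => -[i0 q0] _ /=; case: (i == i0) => /=; last exact: big1.
  exact: Ea.
rewrite (@prodg_single _ _ _ (i, q)) /= ?eqxx ?GRing.subrr ?eqxx // => -[i0 q0].
by rewrite -pair_eqE /= GRing.subr_eq0 (eq_sym i) (eq_sym q) => /negPf->.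
Qed.

End Characters.

(** * Rewriting a word along its path of exponent vectors *)

Section Rewriting.

Variables (n : nat) (I : finType).
Local Notation M := {ffun I -> 'Z_n}.
Local Notation e i := (unit_vec n i : M).

(** Reading w as a path in the Cayley graph of M that starts at q, each letter
   is recorded together with its position; an inverse letter is recorded at
   its end point. *)
Fixpoint path_word (q : M) (w : gword I) : gword (I * M) :=
  match w with
  | (i, false) :: w' => ((i, q), false) :: path_word (q + e i)%R w'
  | (i, true) :: w' => ((i, q - e i)%R, true) :: path_word (q - e i)%R w'
  | [::] => [::]
  end.

Fixpoint wdeg (w : gword I) : M :=
  match w with
  | (i, b) :: w' => ((if b then - e i else e i) + wdeg w')%R
  | [::] => 0%R
  end.

(** With T a transversal, these are Schreier generators of the kernel of the
   map to M; the factors T cancel along the path. *)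
Lemma geval_path_word (G : groupType) (s : I -> G) (T : M -> G) q w :
  T q * geval s w =
    geval (fun p => T p.2 * s p.1 * (T (p.2 + e p.1)%R)^-1) (path_word q w) * T
      (q + wdeg w)%R.
Proof.
elim: w q => [|[i [|]] w IHw] q /=.
- by rewrite !geval_nil GRing.addr0 mulg1 mul1g.
- rewrite !geval_cons /= GRing.addrA -mulgA -IHw !invgM invgK GRing.subrK.
  by rewrite !mulgA mulgVK.
by rewrite !geval_cons /= GRing.addrA -mulgA -IHw !mulgA mulgVK.
Qed.

Hypothesis n_gt1 : 1 < n.

Lemma geval_wdeg (G : groupType) (s : I -> G) w :
    (forall x y : G, commute x y) -> (forall x : G, x ^+ n = 1) ->
  geval s w = pw s (wdeg w).
Proof.
move=> cG expG; elim: w => [|[i b] w IHw]; first by rewrite geval_nil pw0.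
rewrite geval_cons /= (pwD n_gt1 cG expG) IHw; congr (_ * _).
case: b; rewrite ?(pw_unit n_gt1 expG) //.
apply: mulg1_eq; rewrite -[X in X * _](pw_unit n_gt1 expG s i).
by rewrite -(pwD n_gt1 cG expG) GRing.subrr pw0.
Qed.

(** The same path is followed by the values of a base component. *)
Lemma wbase_path_word (A B : finGroupType) (s : I -> wreath A B) q w :
    (forall x y : B, commute x y) -> (forall x : B, x ^+ n = 1) ->
    let T := pw (fun i => wtop (s i)) in
  wbase (geval s w) (T q) = geval (fun p => wbase (s p.1) (T p.2))
    (path_word q w).
Proof.
move=> cB expB T; have TD r i : T (r + e i)%R = T r * wtop (s i).
  by rewrite /T (pwD n_gt1 cB expB) (pw_unit n_gt1 expB).
have TB r i : T (r - e i)%R = T r * (wtop (s i))^-1.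
  by rewrite -{2}[r](GRing.subrK (e i)) TD mulgK.
elim: w q => [|[i [|]] w IHw] q /=; first by rewrite !geval_nil wbase1.
  by rewrite !geval_cons wbaseM wbaseV wtopV -TB IHw.
by rewrite !geval_cons wbaseM -TD IHw.
Qed.

End Rewriting.

(** * Laws of the wreath product hold in every extension *)

Section Sufficiency.

Variables A B : finGroupType.
Local Notation n := (exponent [set: B]).
Local Notation c := (nil_class [set: A]).
Hypotheses (nilA : nilpotent [set: A]) (abB : abelian [set: B]).
Hypotheses (ntB : [set: B] != 1) (coAB : coprime (exponent [set: A]) n).
Variable b : 'I_c -> B.
Hypothesis b_inj : injective (fun mu : {ffun 'I_c -> 'Z_n} => pw b mu).

Let n_gt1 : 1 < n. Proof. exact: exponent_gt1. Qed.
Let cB := active_comm abB.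
Let expB := @active_exponent B.

Section Law.

Variables (I : finType) (w : gword I).
Hypothesis lawW : forall s : I -> wreath A B, geval s w = 1.
Local Notation M := {ffun I -> 'Z_n}.

(** Such an f factors through a function on I * B, which is the base component
   of elements of A wr B with active components beta i. *)
Lemma path_law_factor (beta : I -> B) (f : I * M -> A) :
    (forall i q q', pw beta q = pw beta q' -> f (i, q) = f (i, q')) ->
  geval f (path_word 0%R w) = 1.
Proof.
move=> f_beta.
pose F i y := if [pick q : M | pw beta q == y] is Some q then f (i, q) else 1.
pose s i : wreath A B := wmk (F i) (beta i).
have /= E := wbase_path_word n_gt1 s 0%R w cB expB.
rewrite lawW wbase1 in E; rewrite [RHS]E.
apply: eq_geval => -[i q] /=; rewrite wbase_mk /F.
by case: pickP => [q' /eqP/f_beta-> // | /(_ q)]; rewrite eqxx.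
Qed.

(** At most c characters of M assemble to a map from M to Z_n ^ c, which
   embeds in B; then path_law_factor applies. This is where the rank of B
   enters. *)
Lemma path_law_few (J : finType) (phi : J -> M) (S : {set J}) (f : I * M -> A) :
    #|S| <= c ->
    (forall i q q', (forall j, j \in S -> dot (phi j) q = dot (phi j) q') ->
       f (i, q) = f (i, q')) ->
  geval f (path_word 0%R w) = 1.
Proof.
move=> le_S f_phi.
pose Phi (q : M) : {ffun 'I_c -> 'Z_n} :=
  [ffun t : 'I_c => nth 0%R [seq dot (phi j) q | j <- enum S] t].
have PhiD q q' : Phi (q + q')%R = (Phi q + Phi q')%R.
  apply/ffunP=> t; rewrite !ffunE;
    elim: (enum S) (t : nat) => [|j r IHr] [|k] /=;
    by rewrite ?GRing.addr0 ?dotD ?IHr.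
pose beta i := pw b (Phi (unit_vec n i)).
have betaE q : pw beta q = pw b (Phi q).
  pose h r := pw b (Phi r); suffices hD x y : h (x + y)%R = h x * h y.
    exact/esym/(pw_additive q hD).
  by rewrite /h PhiD (pwD n_gt1 cB expB).
apply: (@path_law_factor beta) => i q q'; rewrite !betaE => /b_inj eqPhi.
apply: f_phi => j Sj; pose k := index j (enum S).
have lt_k : k < size (enum S) by rewrite index_mem mem_enum.
have lt_kc : k < c by apply: leq_trans le_S; rewrite cardE.
have := congr1 (fun g : {ffun _} => g (Ordinal lt_kc)) eqPhi.
by rewrite !ffunE /= !(nth_map j) // nth_index ?mem_enum.
Qed.

(** By char_expansion f is a product of functions of one character each, and
   by geval_few_factors only products of at most c of them have to be
   considered. *)
Lemma path_law_base (f : I * M -> A) : geval f (path_word 0%R w) = 1.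
Proof.
have [F [r [F_dot F_prod]]] := char_expansion n_gt1 coAB f.
rewrite -(eq_geval _ F_prod); apply: geval_few_factors => // S le_S.
apply: (path_law_few (phi := fun j => j.2) le_S) => i q q' eq_dot.
by apply: eq_bigr => j Sj; apply/F_dot/eq_dot.
Qed.

Lemma law_top (s : I -> B) : geval s w = 1.
Proof.
have := congr1 (@wtop A B) (lawW (fun i => active_elt A (s i))).
by rewrite (geval_morph _ _ (@wtopM A B)).
Qed.

Lemma law_wdeg : wdeg n w = 0%R.
Proof.
apply/ffunP=> i; rewrite ffunE; apply: val_inj => /=.
have [b0 _ ob0] := exponent_witness (abelian_nil abB).
have := law_top (fun j => if j == i then b0 else 1).
rewrite (geval_wdeg n_gt1 _ w cB expB) /pw (@prodg_single _ _ _ i) =>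
  [|j /negPf->]; last first.
  exact: expg1n.
rewrite eqxx => /eqP; rewrite -order_dvdn -ob0 => /eqP; rewrite modn_small //.
by rewrite -[X in _ < X](Zp_cast n_gt1).
Qed.

(** The Schreier generators built from the products of powers of the s i lie
   in N, and the word in these generators is a law of A. *)
Lemma law_extension (E : groupType) (s : I -> E) :
  product_variety (var A) (var B) E -> geval s w = 1.
Proof.
case=> N [Q [i [p [varN varQ [i_inj p_surj p_ker]]]]].
have cQ (x y : Q) : commute x y.
  pose t k := if k == 0%N then x else y.
  apply/commgP/eqP.
  rewrite -[RHS](var_law (w := wcomm (wvar 0%N) (wvar 1%N)) varQ _ t).
    by rewrite geval_comm !geval_var.
  by move=> t'; rewrite geval_comm !geval_var; apply/eqP/commgP/cB.
have expQ (x : Q) : x ^+ n = 1.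
  rewrite -[RHS](var_law (w := wpow (wvar 0%N) n) varQ _ (fun=> x)).
    by rewrite geval_pow geval_var.
  by move=> t'; rewrite geval_pow geval_var expB.
pose T : M -> E := pw s.
have pM : {morph p : x y / x * y} := @gmulfM _ _ p.
have pT q : p (T q) = pw (p \o s) q.
  by rewrite /T /pw (big_morph p pM (mmorph1 pM)); apply: eq_bigr => j _;
    rewrite (mmorphX pM).
have /fin_all_exists[g Eg] (x : I * M) : exists y : N,
    i y = T x.2 * s x.1 * (T (x.2 + unit_vec n x.1)%R)^-1.
  apply/p_ker; rewrite !pM (mmorphV pM) !pT.
  by rewrite (pwD n_gt1 cQ expQ) (pw_unit n_gt1 expQ) mulgV.
have := geval_path_word s T 0%R w;
  rewrite GRing.add0r law_wdeg /T pw0 mul1g mulg1 => ->.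
rewrite -(eq_geval _ Eg) -(geval_morph _ _ (@gmulfM _ _ i)).
by rewrite (var_law varN path_law_base) (mmorph1 (@gmulfM _ _ i)).
Qed.

End Law.

Lemma product_variety_sub (E : groupType) :
  product_variety (var A) (var B) E -> var (wreath A B) E.
Proof.
move=> UVE; apply/varP => w lawW s.
pose k := \max_(l <- w) l.1.
pose w' : gword 'I_k.+1 := [seq (inord l.1, l.2) | l <- w].
have ev (G : groupType) (t : nat -> G) :
  geval t w = geval (fun j : 'I_k.+1 => t j) w'.
  rewrite /geval big_map; apply: eq_big_seq => l wl /=.
  by rewrite inordK // ltnS /k (big_rem l) //= leq_maxl.
rewrite -[LHS]/(geval s w) ev; apply: law_extension UVE => t.
have := lawW (fun j => t (inord j));
  rewrite -[word_eval _ _]/(geval _ w) ev => E1.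
by rewrite -[RHS]E1; apply: eq_geval => j; rewrite inord_val.
Qed.

End Sufficiency.

(** * The extension given by a normal subgroup *)

(** The closure proofs are bundled with the predicate so that the group
   structures on the types below can be inferred from the predicate alone. *)
Record normal_pred (E : groupType) := NormalPred {
  in_normal :> pred E;
  in_normal1 : in_normal 1;
  in_normalM : forall x y, in_normal x -> in_normal y -> in_normal (x * y);
  in_normalV : forall x, in_normal x -> in_normal x^-1;
  in_normalJ : forall x y, in_normal x -> in_normal (x ^ y)
}.

Section NormalExtension.

Variables (E : groupType) (P : normal_pred E).

Definition normal_sub := {x : E | P x}.

HB.instance Definition _ := [isSub of normal_sub for @sval E (fun x => P x)].
HB.instance Definition _ := [Choice of normal_sub by <:].

Fact normal_sub_closed : group_closed P.
Proof.
split=> [|x y Px Py]; first exact: in_normal1.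
exact/in_normalM/in_normalV.
Qed.

HB.instance Definition _ :=
  SubChoice_isSubGroup.Build E P normal_sub normal_sub_closed.

Definition normal_rep (x : E) : E := choose (fun y => P (x^-1 * y)) x.

Lemma normal_repP x : P (x^-1 * normal_rep x).
Proof. by apply: (@chooseP _ (fun y => P (x^-1 * y)));
  rewrite mulVg in_normal1. Qed.

Lemma normal_rep_eq x y : normal_rep x = normal_rep y <-> P (x^-1 * y).
Proof.
split=> [eqxy | Pxy].
  have := in_normalM (normal_repP x) (in_normalV (normal_repP y)).
  by rewrite eqxy invMg invgK !mulgA mulgK.
have eqP z : P (x^-1 * z) = P (y^-1 * z).
  apply/idP/idP => Pz.
    have -> : y^-1 * z = (x^-1 * y)^-1 * (x^-1 * z)
      by rewrite invMg invgK !mulgA mulgK.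
    by apply: in_normalM Pz; apply: in_normalV.
  have -> : x^-1 * z = (x^-1 * y) * (y^-1 * z) by rewrite !mulgA mulgK.
  exact: in_normalM.
rewrite /normal_rep (eq_choose eqP);
  apply: (@choose_id _ (fun z => P (y^-1 * z))).
  by rewrite -eqP mulVg in_normal1.
by rewrite mulVg in_normal1.
Qed.

Lemma normal_rep_id x : normal_rep (normal_rep x) = normal_rep x.
Proof. by apply/esym/normal_rep_eq/normal_repP. Qed.

(** Cosets are encoded by their chosen representatives. *)
Definition normal_quo := {x : E | normal_rep x == x}.

HB.instance Definition _ := [isSub of normal_quo for @sval E _].
HB.instance Definition _ := [Choice of normal_quo by <:].

Definition quo_proj (x : E) : normal_quo :=
  exist _ (normal_rep x) (introT eqP (normal_rep_id x)).

Lemma quo_proj_eq x y : quo_proj x = quo_proj y <-> P (x^-1 * y).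
Proof.
rewrite -normal_rep_eq; split=> [[] // | eqxy]; exact: val_inj.
Qed.

Lemma quo_projK (u : normal_quo) : quo_proj (val u) = u.
Proof. by apply: val_inj; apply/eqP; apply: (valP u). Qed.

Definition quo_mul (u v : normal_quo) := quo_proj (val u * val v).
Definition quo_inv (u : normal_quo) := quo_proj (val u)^-1.

Lemma quo_projM x y : quo_proj (x * y) = quo_mul (quo_proj x) (quo_proj y).
Proof.
apply/quo_proj_eq; rewrite /=; set x' := normal_rep x; set y' := normal_rep y.
have -> : (x * y)^-1 * (x' * y') = (x^-1 * x') ^ y * (y^-1 * y').
  by rewrite invMg conjgE !mulgA mulgK.
by apply: in_normalM; [apply: in_normalJ|]; apply: normal_repP.
Qed.

Lemma quo_projV x : quo_proj x^-1 = quo_inv (quo_proj x).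
Proof.
apply/quo_proj_eq; rewrite /= invgK; set x' := normal_rep x.
have -> : x * x'^-1 = ((x^-1 * x')^-1) ^ x^-1.
  by rewrite conjgE invgK invMg invgK !mulgA mulgK.
by apply/in_normalJ/in_normalV/normal_repP.
Qed.

Fact quo_mulA : associative quo_mul.
Proof.
move=> u v w; rewrite -(quo_projK u) -(quo_projK v) -(quo_projK w).
by rewrite -!quo_projM mulgA.
Qed.

Fact quo_mul1 : left_id (quo_proj 1) quo_mul.
Proof. by move=> u; rewrite -(quo_projK u) -quo_projM mul1g. Qed.

Fact quo_mulr1 : right_id (quo_proj 1) quo_mul.
Proof. by move=> u; rewrite -(quo_projK u) -quo_projM mulg1. Qed.

Fact quo_mulV : left_inverse (quo_proj 1) quo_inv quo_mul.
Proof. by move=> u; rewrite -(quo_projK u) -quo_projV -quo_projM mulVg. Qed.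

Fact quo_mulrV : right_inverse (quo_proj 1) quo_inv quo_mul.
Proof. by move=> u; rewrite -(quo_projK u) -quo_projV -quo_projM mulgV. Qed.

HB.instance Definition _ :=
  isGroup.Build normal_quo quo_mulA quo_mul1 quo_mulr1 quo_mulV quo_mulrV.

HB.instance Definition _ := isMultiplicative.Build E normal_quo quo_proj
  quo_projM.

Lemma normal_extension :
  is_extension (val : {multiplicative normal_sub -> E})
               (quo_proj : {multiplicative E -> normal_quo}).
Proof.
split=> [|q|x]; first exact: val_inj.
  by exists (val q); apply: quo_projK.
split=> [/esym/quo_proj_eq | [y <-]].
  by rewrite invg1 mul1g => Px; exists (exist _ x Px).
by apply/esym/quo_proj_eq; rewrite invg1 mul1g; apply: (valP y).
Qed.

End NormalExtension.

(** * The variety of a wreath product is contained in the product variety *)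

Section VerbalExtension.

Variables (A B : finGroupType) (E : groupType).
Hypothesis varE : var (wreath A B) E.

(** The verbal subgroup for the laws of B. Values of laws already form a
   subgroup, as laws may be multiplied after renaming their letters. *)
Definition verbal (x : E) : Prop :=
  exists (w : word) (s : nat -> E), satisfies_law B w /\ x = geval s w.

Definition verbalb (x : E) : bool := if excluded_middle_informative (verbal x)
  then true else false.

Lemma verbalP x : reflect (verbal x) (verbalb x).
Proof. by rewrite /verbalb; case: excluded_middle_informative => vx;
  constructor. Qed.

Definition interleave (s t : nat -> E) (k : nat) :
  E := if odd k then t k./2 else s k./2.

Fact verbalM x y : verbalb x -> verbalb y -> verbalb (x * y).
Proof.
case/verbalP=> [u [s [Bu ->]]] /verbalP[v [t [Bv ->]]]; apply/verbalP.
exists (wsubst (fun k => wvar k.*2) u ++ wsubst (fun k => wvar k.*2.+1) v).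
exists (interleave s t); split=> [r|].
  rewrite -[LHS]/(geval r _) geval_cat !geval_subst.
  by rewrite [geval _ u]Bu [geval _ v]Bv mulg1.
rewrite geval_cat !geval_subst; congr (_ * _); apply: eq_geval => k.
  by rewrite geval_var /interleave odd_double doubleK.
by rewrite geval_var /interleave /= odd_double uphalf_double.
Qed.

Fact verbalV x : verbalb x -> verbalb x^-1.
Proof.
case/verbalP=> [u [s [Bu ->]]]; apply/verbalP; exists (winv u), s.
split=> [r|]; last by rewrite geval_inv.
by rewrite -[LHS]/(geval r _) geval_inv [geval r u]Bu invg1.
Qed.

Fact verbalJ x y : verbalb x -> verbalb (x ^ y).
Proof.
case/verbalP=> [u [s [Bu ->]]]; apply/verbalP; exists u, (fun k => s k ^ y).
split=> //; apply: (geval_morph (f := fun z => z ^ y)) => a b; exact: conjMg.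
Qed.

Fact verbal1 : verbalb 1.
Proof.
by apply/verbalP; exists [::], (fun=> 1); split=> [r|];
  [apply: geval_nil | rewrite geval_nil].
Qed.

Definition verbal_normal := NormalPred verbal1 verbalM verbalV verbalJ.

(** Substituting laws of B into a law u of A gives a law of A wr B: the inner
   words take values in the base group, which is a power of A. *)
Lemma var_verbal_sub : var A (normal_sub verbal_normal).
Proof.
apply/varP => u Au s.
have /(_ _)/constructive_indefinite_description wordE j :
    exists wt : word * (nat -> E), satisfies_law B wt.1 /\ val (s j) =
      geval wt.2 wt.1.
  by have /verbalP[w [t []]] := valP (s j); exists (w, t).
pose w j := (sval (wordE j)).1; pose t j := (sval (wordE j)).2.
have Bw j : satisfies_law B (w j) := (svalP (wordE j)).1.
have Es j : val (s j) = geval (t j) (w j) := (svalP (wordE j)).2.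
apply: val_inj; rewrite -[word_eval s u]/(geval s u).
rewrite (geval_morph (f := val) s u) => [|x y]; last exact: valM.
rewrite val1 (eq_geval _ Es).
pose v : gword (nat * nat) := wsubst
  (fun j => wsubst (fun k => wvar (j, k)) (w j)) u.
have := var_law (w := v) varE _ (fun p => t p.1 p.2).
rewrite geval_subst => <-; last first.
  move=> r; rewrite geval_subst.
  pose f j : {dffun B -> A} :=
    [ffun x => wbase (geval (fun k => r (j, k)) (w j)) x].
  rewrite (eq_geval (t := @base_elt A B \o f)) => [|j].
    have fu := (varP _ _).1 (@var_dffun A B) u Au f.
    by rewrite -(geval_morph _ _ (@base_eltM A B)) [geval f u]fu
      (mmorph1 (@base_eltM A B)).
  rewrite geval_subst (eq_geval (t := fun k => r (j, k))) => [|k];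
    last exact: geval_var.
  apply: base_eltE; rewrite (geval_morph _ _ (@wtopM A B)); exact: Bw.
by apply: eq_geval => j; rewrite geval_subst; apply: eq_geval => k;
  rewrite geval_var.
Qed.

Lemma var_verbal_quo : var B (normal_quo verbal_normal).
Proof.
apply/varP => u Bu s; rewrite -[LHS]/(geval s u).
rewrite (eq_geval (t := @quo_proj _ verbal_normal \o (fun j => val (s j))));
  last first.
  by move=> j; rewrite /= quo_projK.
rewrite -(geval_morph _ _ (@quo_projM _ verbal_normal)).
apply/esym/quo_proj_eq; rewrite invg1 mul1g; apply/verbalP.
by exists u, (fun j => val (s j)).
Qed.

Lemma var_wreath_product : product_variety (var A) (var B) E.
Proof.
exists (normal_sub verbal_normal), (normal_quo verbal_normal), val,
  (@quo_proj _ verbal_normal).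
by split; [exact: var_verbal_sub | exact: var_verbal_quo | exact: normal_extension].
Qed.

End VerbalExtension.

(** * The criterion *)

Lemma cyclic_power_coordinates (B : finGroupType) (H : {group B}) n c :
    1 < n -> abelian [set: B] -> (forall x : B, x ^+ n = 1) ->
    H \isog cyclic_power n c ->
  exists b : 'I_c -> B, injective (fun mu : {ffun 'I_c -> 'Z_n} => pw b mu).
Proof.
move=> n_gt1 abB expB isoH.
move: isoH; rewrite cyclic_powerT // isog_sym => /isogP[f inj_f _];
  exists (fun i => f (unit_vec n i)) => mu nu.
have fD (x y : {ffun 'I_c -> 'Z_n}) : f (x + y)%R = f x * f y.
  rewrite -morphM ?inE //; congr (f _); by apply/ffunP=> i; rewrite !ffunE.
rewrite -!(pw_additive _ fD); by apply: (injmP inj_f); rewrite inE.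
Qed.

Theorem theorem1 (A B : finGroupType)
    (ntA : [set: A] != 1) (ntB : [set: B] != 1) :
  eq_group_class (var (wreath A B)) (product_variety (var A) (var B)) <->
  [/\ coprime (exponent [set: A]) (exponent [set: B]),
      nilpotent [set: A] /\ abelian [set: B] &
      exists H : {group B},
        H \isog cyclic_power (exponent [set: B]) (nil_class [set: A])].
Proof.
split=> [eqUV | [coAB [nilA abB] [H isoH]] E].
  have varW (Q : finGroupType) : var B Q -> var (wreath A B) (wreath A Q).
    by move=> varBQ; apply/eqUV; apply: wreath_product_variety.
  have nilA := product_base_nilpotent varW ntB.
  have abB := product_active_abelian varW ntB ntA.
  have coAB := product_coprime_exponents varW.
  by split=> //; apply: product_rank.
split; first exact: var_wreath_product.
have [b b_inj] := cyclic_power_coordinates (exponent_gt1 ntB) abB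
  (@active_exponent B) isoH.
exact: product_variety_sub b_inj E.
Qed.
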